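(* Let $G$ be a countably infinite discrete amenable group. Let $\pi\colon (X,G)\to (Y,G)$ be a factor map between two $G$-systems, let $\widetilde{\pi}\colon (\mathcal{M}(X),G)\to(\mathcal{M}(Y),G)$ be the factor map induced by $\pi$, and for each $n\in\mathbb{N}$ let $\widetilde{\pi}_n\colon (\mathcal{M}_n(X),G)\to(\mathcal{M}_n(Y),G)$ be the restriction of $\widetilde{\pi}$ to $\mathcal{M}_n(X)$. Suppose that $\mathrm{supp}(Y,G)=Y$. Then the following are equivalent: (1) $\pi$ has relative uniformly positive entropy; (2) $\widetilde{\pi}_n$ has relative uniformly positive entropy for some $n\in\mathbb{N}$; (3) $\widetilde{\pi}_n$ has relative uniformly positive entropy for every $n\in\mathbb{N}$; (4) $\widetilde{\pi}$ has relative uniformly positive entropy.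
   Context: $\mathbb{N}=\{1,2,\dots\}$. A $G$-system $(X,G)$ is a compact metric space $X$ together with an action of $G$ on $X$ by homeomorphisms. A factor map $\pi\colon(X,G)\to(Y,G)$ is a continuous surjective map with $\pi(gx)=g\pi(x)$ for all $g\in G$, $x\in X$. $\mathcal{M}(X)$ is the space of Borel probability measures on $X$ with the weak*-topology (compact metrizable). The induced $G$-system $(\mathcal{M}(X),G)$ is given by $(g\mu)(A)=\mu(g^{-1}A)$ for Borel $A\subseteq X$. For $n\in\mathbb{N}$, $\mathcal{M}_n(X)=\{\frac1n\sum_{i=1}^n\delta_{x_i}: x_1,\dots,x_n\in X\}$, where $\delta_x$ is the Dirac measure at $x$; this is a closed $G$-invariant subset of $\mathcal{M}(X)$, so $(\mathcal{M}_n(X),G)$ is a $G$-system. The induced map is $(\widetilde{\pi}\mu)(B)=\mu(\pi^{-1}B)$ for Borel $B\subseteq Y$; $\widetilde\pi$ and $\widetilde\pi_n=\widetilde\pi|_{\mathcal{M}_n(X)}\colon \mathcal{M}_n(X)\to\mathcal{M}_n(Y)$ are factor maps. For $\mu\in\mathcal{M}(X)$, $\mathrm{supp}(\mu)$ is the smallest closed set of full $\mu$-measure. $\mathrm{supp}(X,G)$ is the union of $\mathrm{supp}(\mu)$ over all $G$-invariant $\mu\in\mathcal{M}(X)$. Følner sequence: a sequence $\{F_n\}$ of nonempty finite subsets of $G$ with $|F_n\Delta gF_n|/|F_n|\to0$ for all $g\in G$. For a factor map $\pi\colon(X,G)\to(Y,G)$ and a finite cover $\mathcal{U}$ of $X$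 by Borel sets, let $N(\mathcal{U},E)$ be the minimal cardinality of a subfamily of $\mathcal{U}$ covering $E\subseteq X$, $N(\mathcal{U}|\pi)=\sup_{y\in Y}N(\mathcal{U},\pi^{-1}(y))$, and $$h_{top}(\mathcal{U},G|\pi)=\lim_{n\to\infty}\frac{1}{|F_n|}\log N(\mathcal{U}_{F_n}|\pi),\qquad \mathcal{U}_{F}=\bigvee_{g\in F}g^{-1}\mathcal{U},$$ where $\bigvee$ denotes the common refinement (all intersections choosing one element from each cover). The limit exists and does not depend on the Følner sequence. A finite cover $\mathcal{U}=\{U_1,\dots,U_n\}$ of $X$ is non-dense-on-$\pi$-fiber if there is $y\in Y$ such that $\pi^{-1}(y)$ is not contained in any $\overline{U_i}$. The factor map $\pi$ has relative uniformly positive entropy (rel-u.p.e.) if $h_{top}(\mathcal{U},G|\pi)>0$ for every non-dense-on-$\pi$-fiber open cover $\mathcal{U}$ of $X$ with two elements. *)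

(* Defs.v *)
From HB Require Import structures.
From mathcomp Require Import all_boot all_order all_algebra finmap.
From mathcomp Require Import all_classical all_reals all_analysis measurable_realfun.

Set Implicit Arguments.
Unset Strict Implicit.
Unset Printing Implicit Defensive.

Import Order.TTheory GRing.Theory Num.Theory.
Import numFieldNormedType.Exports.

Local Open Scope classical_set_scope.
Local Open Scope ring_scope.

(* The measurable types of the library are pointed, hence the base point. *)
#[short(type="pmetricType")]
HB.structure Definition PMetric (K : numDomainType) :=
  {M of Metric K M & Pointed M}.

Section Groups.
Variables (R : realType) (G : groupType).

Definition fset_lmul (g : G) (F : {fset G}) : {fset G} :=
  [fset (g * x)%g | x in F]%fset.

Definition fset_symdiff (A B : {fset G}) : {fset G} :=
  ((A `\` B) `|` (B `\` A))%fset.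

Definition folner (F : nat -> {fset G}) : Prop :=
  (forall n, F n != fset0) /\
  forall g : G,
    (#|` fset_symdiff (F n) (fset_lmul g (F n))|%:R / #|` F n|%:R : R)
      @[n --> \oo] --> (0 : R).

Definition amenable : Prop := exists F, folner F.

End Groups.

(* No inverse is recorded: [gact g] is a homeomorphism because [gact g^-1] is
   its continuous inverse. *)
Record gaction (G : groupType) (X : topologicalType) := GAction {
  gact :> G -> X -> X ;
  gact1 : forall x, gact 1%g x = x ;
  gactM : forall g h x, gact (g * h)%g x = gact g (gact h x) ;
  gact_continuous : forall g, continuous (gact g) }.
Arguments gact_continuous {G X} _ _.

Record factor_map (G : groupType) (X Y : topologicalType)
    (aX : gaction G X) (aY : gaction G Y) := FactorMap {
  fmap :> X -> Y ;
  fmap_continuous : continuous fmap ;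
  fmap_surj : forall y, exists x, fmap x = y ;
  fmap_equivariant : forall g x, fmap (aX g x) = aY g (fmap x) }.
Arguments fmap_continuous {G X Y aX aY} _.

Section Entropy.
Variables (R : realType) (G : groupType) (X Y : topologicalType).
Variables (a : gaction G X) (pi : X -> Y).

(* A finite cover is a family indexed by a finite type I; the default value
   [#|I|] of the minimum is the cardinality of the whole family. *)
Definition covnum (I : finType) (U : I -> set X) (E : set X) : nat :=
  \big[minn/#|I|]_(A : {set I} | `[< E `<=` \bigcup_(i in [set` A]) U i >]) #|A|.

Definition rel_covnum (I : finType) (U : I -> set X) : R :=
  sup [set (covnum U (pi @^-1` [set y]))%:R | y in [set: Y]].

Definition join_cover (I : finType) (U : I -> set X) (F : {fset G})
    (s : {ffun F -> I}) : set X :=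
  \bigcap_(g in [set: F]) (a (\val g) @^-1` U (s g)).

Definition rel_htop (F : nat -> {fset G}) (I : finType) (U : I -> set X) : R :=
  lim ((#|` F n|%:R^-1 * ln (rel_covnum (@join_cover I U (F n))))
         @[n --> \oo]).

Definition nondense_on_fiber (I : finType) (U : I -> set X) : Prop :=
  exists y : Y, forall i, ~ (pi @^-1` [set y] `<=` closure (U i)).

(* The limit [rel_htop F U] exists and is the same for all Folner sequences F,
   so for amenable G the last quantifier may equally be read as "for some F". *)
Definition rel_upe : Prop :=
  forall U : 'I_2 -> set X,
    (forall i, open (U i)) -> \bigcup_i U i = [set: X] ->
    nondense_on_fiber U ->
    forall F, folner R F -> 0 < rel_htop F U.

End Entropy.

Section Measures.
Variables (R : realType).

Local Notation borel X := (g_sigma_algebraType (@open X)).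

(* A library measure is a function on all sets, of which only the values on
   measurable sets are constrained; giving the other sets the value 0 makes
   equality in [bprob] the equality of Borel measures. *)
Record bprob (X : ptopologicalType) := BProb {
  bprob_measure :> probability (borel X) R ;
  bprobN : forall A, ~ measurable A -> bprob_measure A = 0%E }.

HB.instance Definition _ (X : ptopologicalType) := gen_eqMixin (bprob X).
HB.instance Definition _ (X : ptopologicalType) := gen_choiceMixin (bprob X).

(* Weak-* topology. *)
Definition bprob_eval (X : ptopologicalType) (mu : bprob X)
    : {ptws continuousType X R -> R} :=
  fun f => \int[mu]_x f x.
HB.instance Definition _ (X : ptopologicalType) :=
  Topological.copy (bprob X) (initial_topology (@bprob_eval X)).

Lemma bprobP (X : ptopologicalType) (mu nu : bprob X) :
  (forall A, measurable A -> mu A = nu A) -> mu = nu.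
Proof.
move=> eq_mn.
have e : (mu : set (borel X) -> \bar R) = nu.
  apply/funext => A; have [mA|nA] := pselect (measurable A); first exact: eq_mn.
  by rewrite !bprobN.
move: mu nu {eq_mn} e => [mu hmu] [nu hnu] /= e.
suff emn : mu = nu.
  by move: hmu hnu; rewrite emn => hmu hnu; congr BProb; exact: Prop_irrelevance.
move: mu nu e {hmu hnu} => [mu cmu] [nu cnu] /= e.
move: cmu cnu; rewrite e => cmu cnu; congr Probability.Pack.
case: cmu cnu => [[a1 a2] [b] [c] [d] [e1] [f] [g]].
case=> [[a1' a2'] [b'] [c'] [d'] [e1'] [f'] [g']].
have ? := Prop_irrelevance a1' a1; have ? := Prop_irrelevance a2' a2; subst.
have ? := Prop_irrelevance b' b; subst.
have ? := Prop_irrelevance c' c; subst.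
have ? := Prop_irrelevance d' d; subst.
have ? := Prop_irrelevance e1' e1; subst.
have ? := Prop_irrelevance f' f; have ? := Prop_irrelevance g' g; by subst.
Qed.

Section Restriction.
Local Open Scope ereal_scope.
Variables (X : ptopologicalType) (mu : probability (borel X) R).

Definition brestr (A : set (borel X)) : \bar R :=
  if `[< measurable A >] then mu A else 0.

Lemma brestrE A : measurable A -> brestr A = mu A.
Proof. by move=> mA; rewrite /brestr asboolT. Qed.

Let brestr0 : brestr set0 = 0.
Proof. by rewrite brestrE. Qed.

Let brestr_ge0 A : 0 <= brestr A.
Proof. by rewrite /brestr; case: ifP. Qed.

Let brestr_sigma_additive : semi_sigma_additive brestr.
Proof.
move=> F mF tF mUF; rewrite brestrE//.
under eq_fun do under eq_bigr do rewrite brestrE//.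
exact: measure_semi_sigma_additive.
Qed.

HB.instance Definition _ := isMeasure.Build _ _ _ brestr
  brestr0 brestr_ge0 brestr_sigma_additive.

Let brestrT : brestr setT = 1.
Proof. by rewrite brestrE// probability_setT. Qed.

HB.instance Definition _ := Measure_isProbability.Build _ _ _ brestr brestrT.

Lemma brestrN A : ~ measurable A -> brestr A = 0.
Proof. by move=> nA; rewrite /brestr asboolF. Qed.

Definition bprob_of : bprob X := BProb brestrN.

End Restriction.

Section Pushforward.
Variables (X Y : ptopologicalType) (f : X -> Y).
Hypothesis cf : continuous f.

Lemma borel_measurable : measurable_fun [set: borel X] (f : borel X -> borel Y).
Proof.
apply: (@measurability _ _ (borel X) (borel Y) setT f (@open Y)) => //.
move=> _ [B oB <-]; rewrite setTI; apply: sub_sigma_algebra.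
by move/continuousP : cf; exact.
Qed.

Definition borel_mfun : {mfun borel X >-> borel Y} :=
  HB.pack (f : borel X -> borel Y)
    (isMeasurableFun.Build _ _ (borel X) (borel Y) f borel_measurable).

Definition bpush (mu : bprob X) : bprob Y :=
  bprob_of (distribution (bprob_measure mu) borel_mfun).

Lemma bpushE mu A : measurable A -> bpush mu A = mu (f @^-1` A).
Proof. by move=> mA; rewrite /= brestrE. Qed.


Lemma borel_measurableR (h : X -> R) : continuous h ->
  measurable_fun [set: borel X] (h : borel X -> R).
Proof.
move=> ch.
apply: (measurability _ (RGenOpens.measurableE R)).
move=> _ [_ [a [b ->]] <-]; rewrite setTI; apply: sub_sigma_algebra.
by move/continuousP : ch; apply; exact: interval_open.
Qed.

End Pushforward.

Lemma bpush_eval (X Y : ptopologicalType) (f : X -> Y) (cf : continuous f)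
    (mu : bprob X) (h : continuousType Y R) :
  bprob_eval (bpush cf mu) h = bprob_eval mu (h \o mkcts cf).
Proof.
rewrite /bprob_eval /Rintegral; congr fine.
rewrite (eq_measure_integral (distribution (bprob_measure mu) (borel_mfun cf)));
  last by move=> A mA _; rewrite /= brestrE.
have mh : measurable_fun [set: borel Y] (fun y : borel Y => (h y : R)%:E).
  by apply/measurable_EFinP; apply: borel_measurableR; exact: cts_fun.
rewrite integralE [RHS]integralE; congr (_ - _)%E.
  rewrite (ge0_integral_distribution (borel_mfun cf))//; last first.
    exact: measurable_funepos.
  by rewrite -funepos_comp.
rewrite (ge0_integral_distribution (borel_mfun cf))//; last first.
  exact: measurable_funeneg.
by rewrite -funeneg_comp.
Qed.

Lemma bprob_eval_continuous (X : ptopologicalType) (h : continuousType X R) :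
  continuous (fun mu : bprob X => bprob_eval mu h : R).
Proof.
move=> mu; apply: (@continuous_comp _ _ _ (@bprob_eval X)
  (fun u : {ptws continuousType X R -> R} => u h)).
  exact: (@initial_continuous (bprob X) _ (@bprob_eval X)).
exact: (@proj_continuous _ (fun=> R) h).
Qed.

Lemma bpush_continuous (X Y : ptopologicalType) (f : X -> Y)
    (cf : continuous f) : continuous (bpush cf).
Proof.
apply: (@continuous_comp_initial (bprob Y) (bprob X) _ (@bprob_eval Y)) => mu.
apply/cvg_sup; first exact/fmap_filter/nbhs_filter.
move=> h; move: mu.
apply/(@continuousP _ (initial_topology (@^~ h))) => _ [W oW <-].
rewrite [X in open X](_ : _ =
    (fun mu : bprob X => bprob_eval mu (h \o mkcts cf) : R) @^-1` W); last first.
  by apply/funext => mu; rewrite /preimage/= bpush_eval.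
by apply: open_comp => // mu _; exact: bprob_eval_continuous.
Qed.

Lemma bpush_comp (X Y Z : ptopologicalType) (f : X -> Y) (g : Y -> Z) (h : X -> Z)
    (cf : continuous f) (cg : continuous g) (ch : continuous h) mu :
  h =1 g \o f -> bpush ch mu = bpush cg (bpush cf mu).
Proof.
move=> /funext hE; apply: bprobP => A mA; rewrite !bpushE ?hE//.
by rewrite -[X in measurable X]setTI; exact: (borel_measurable cg).
Qed.

Lemma bpush_id (X : ptopologicalType) (f : X -> X) (cf : continuous f) mu :
  f =1 id -> bpush cf mu = mu.
Proof. by move=> /funext fE; apply: bprobP => A mA; rewrite bpushE// fE. Qed.

Section Systems.
Variables (G : groupType) (X : ptopologicalType) (a : gaction G X).

Definition bprob_act (g : G) : bprob X -> bprob X := bpush (gact_continuous a g).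

Lemma bprob_act1 mu : bprob_act 1%g mu = mu.
Proof. by apply: bpush_id => x; rewrite gact1. Qed.

Lemma bprob_actM g h mu : bprob_act (g * h)%g mu = bprob_act g (bprob_act h mu).
Proof. by apply: bpush_comp => x; rewrite gactM. Qed.

Definition bprob_gaction : gaction G (bprob X) :=
  GAction bprob_act1 bprob_actM (fun g => @bpush_continuous _ _ _ (gact_continuous a g)).

Definition bsupp (mu : bprob X) : set X :=
  \bigcap_(C in [set C : set X | closed C /\ mu C = 1%E]) C.

Definition supp_system : set X :=
  \bigcup_(mu in [set mu | forall g, bprob_act g mu = mu]) bsupp mu.

End Systems.

Section AverageDirac.
Variable n : nat.

Definition bprob_n (X : ptopologicalType) : set (bprob X) :=
  [set mu : bprob X | exists x : 'I_n -> borel X, forall A : set (borel X), measurable A ->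
    mu A = (n%:R^-1%:E * \sum_(i < n) \d_(x i) A)%E].
Arguments bprob_n : clear implicits.

Lemma bpush_bprob_n (X Y : ptopologicalType) (f : X -> Y) (cf : continuous f)
  mu : bprob_n X mu -> bprob_n Y (bpush cf mu).
Proof.
move=> [x mux]; exists (f \o x) => A mA; rewrite bpushE// mux//.
by rewrite -[X in measurable X]setTI; exact: (borel_measurable cf).
Qed.

Definition bpush_n (X Y : ptopologicalType) (f : X -> Y) (cf : continuous f)
    (mu : bprob_n X) : bprob_n Y :=
  SigSub (mem_set (bpush_bprob_n cf (set_valP mu))).

Lemma bpush_n_continuous (X Y : ptopologicalType) (f : X -> Y)
  (cf : continuous f) : continuous (bpush_n cf).
Proof.
apply: (@continuous_comp_initial (bprob_n Y) _ _ set_val) => mu.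
apply: (@continuous_comp _ _ _ set_val (bpush cf)).
  exact: (@initial_continuous (bprob_n X) _ set_val).
exact: bpush_continuous.
Qed.

Section Action.
Variables (G : groupType) (X : ptopologicalType) (a : gaction G X).

Definition bprob_n_act (g : G) : bprob_n X -> bprob_n X :=
  bpush_n (gact_continuous a g).

Lemma bprob_n_act1 mu : bprob_n_act 1%g mu = mu.
Proof. by apply: val_inj; exact: (bprob_act1 a (val mu)). Qed.

Lemma bprob_n_actM g h mu :
  bprob_n_act (g * h)%g mu = bprob_n_act g (bprob_n_act h mu).
Proof. by apply: val_inj; exact: (bprob_actM a g h (val mu)). Qed.

Definition bprob_n_gaction : gaction G (bprob_n X) :=
  GAction bprob_n_act1 bprob_n_actM
    (fun g => @bpush_n_continuous _ _ _ (gact_continuous a g)).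

End Action.
End AverageDirac.

End Measures.

(* Main.v *)
From HB Require Import structures.
From mathcomp Require Import all_boot all_order all_algebra perm finmap.
From mathcomp Require Import all_classical all_reals all_analysis measurable_realfun.
From mathcomp Require Import zify ring lra.
Require Import Defs.

(** Write [J] independent for a pair of subsets [(A0, A1)] of [X] if some fibre of [pi]
    contains, for every [s : J -> {0,1}], a point [x] with [g x] in [A_(s g)] for all
    [g] in [J].  A Sauer-Shelah argument for partial patterns shows that positive
    entropy of a two-element cover relative to [pi] yields independent subsets of
    positive density in the Folner sets, for the pair of complements; conversely
    [2 ^ #|J|] elements are needed to cover the fibre.  The limit defining the entropy
    exists by the Ornstein-Weiss lemma.

    From [X] to measures: two measures over the same measure on [Y] are approximated
    by [sum w_k delta_(x_k)] and [sum w_k delta_(x'_k)] with [pi x_k = pi x'_k]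
    (relatively independent coupling).  Each pair [(x_k, x'_k)] has neighbourhoods
    with independent sets of positive density: if [x_k <> x'_k] by relative u.p.e.,
    and if [x_k = x'_k] either by pairing with another point of the fibre or, when the
    fibre is a singleton, because [pi x_k] lies in the support of an invariant
    measure.  Families of finite sets that are hereditary, translation invariant and
    of positive density are stable under intersection, so that one set [J] serves all
    [k], with a different fibre for each [k].

    From measures to [X]: let [f_i] be a bump function outside [U_i] and consider the
    cover of the measures by the sets [int f_i < 3/4].  An independent set [J] yields
    measures [mu_s] over one [nu] with [int f_(s g) o g dmu_s >= 3/4]; averaging over
    [s] and over [nu] gives a fibre in which, for many [s], some point follows [s] on
    three quarters of [J].  Since Hamming balls of that radius are exponentially small,
    covering this fibre takes exponentially many sets. *)

Set Implicit Arguments.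
Unset Strict Implicit.
Unset Printing Implicit Defensive.

Import Order.TTheory GRing.Theory Num.Theory.
Import numFieldNormedType.Exports.

Local Open Scope classical_set_scope.
Local Open Scope ring_scope.

(** * Translates of finite subsets of a group *)

Section Translates.
Local Open Scope fset_scope.
Variable G : groupType.
Implicit Types A B K I : {fset G}.

Definition fset_rmul A (g : G) : {fset G} := [fset (x * g)%g | x in A].

Lemma in_fset_rmul A g x : (x \in fset_rmul A g) = ((x * g^-1)%g \in A).
Proof.
apply/imfsetP/idP => [[y yA ->]|xA]; first by rewrite mulgK.
by exists (x * g^-1)%g => //; rewrite mulgVK.
Qed.

Lemma in_fset_lmul A g x : (x \in fset_lmul g A) = ((g^-1 * x)%g \in A).
Proof.
apply/imfsetP/idP => [[y yA ->]|xA]; first by rewrite mulKg.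
by exists (g^-1 * x)%g => //; rewrite mulVKg.
Qed.

Lemma card_fset_rmul A g : #|` fset_rmul A g| = #|` A|.
Proof. by rewrite card_imfset//; exact: mulIg. Qed.

Lemma card_fset_lmul A g : #|` fset_lmul g A| = #|` A|.
Proof. by rewrite card_imfset//; exact: mulgI. Qed.

Lemma card_fset_sep (T : choiceType) (A : {fset T}) (P : pred T) :
  #|` [fset x in A | P x]| = (\sum_(x <- A) P x)%N.
Proof.
elim/finSet_rect: A => A IH; have [->|[a aA]] := fset_0Vmem A.
  by rewrite big_seq_fset0 (_ : [fset _ | _ in _ & _] = fset0) ?cardfs0//;
     apply/fsetP => x; rewrite !inE.
rewrite (big_fsetD1 a)//= -IH; last exact: fproperD1.
case Pa : (P a).
  rewrite (_ : [fset x in A | P x] = a |` [fset x in A `\ a | P x]); last first.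
    by apply/fsetP => x; rewrite !inE; have [->|] := eqVneq x a; rewrite ?aA ?Pa.
  by rewrite cardfsU1 !inE eqxx.
rewrite (_ : [fset x in A | P x] = [fset x in A `\ a | P x])//.
by apply/fsetP => x; rewrite !inE; have [->|] := eqVneq x a; rewrite ?aA ?Pa.
Qed.

(** Both sides count the pairs [(k, c)] in [K x I] with [k c] in [B]. All averaging arguments over
    translates rest on this double count. *)
Lemma sum_card_fset_rmulI I K B :
  (\sum_(c <- I) #|` fset_rmul K c `&` B| =
   \sum_(k <- K) #|` [fset c in I | (k * c)%g \in B]|)%N.
Proof.
under eq_bigr => c _.
  rewrite (_ : _ `&` _ = fset_rmul [fset k in K | (k * c)%g \in B] c); last first.
    by apply/fsetP => x; rewrite !(in_fset_rmul, inE) mulgVK.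
  rewrite card_fset_rmul card_fset_sep.
  over.
by rewrite exchange_big; apply: eq_bigr => k _; rewrite card_fset_sep.
Qed.

Lemma card_fset_preim_le I B k : (#|` [fset c in I | (k * c)%g \in B]| <= #|` B|)%N.
Proof.
rewrite -(card_fset_lmul _ k) fsubset_leq_card//.
by apply/fsubsetP => x; rewrite in_fset_lmul !inE mulVKg => /andP[].
Qed.

End Translates.

(** * Quasi-tilings and the Ornstein-Weiss estimate *)

Section OrnsteinWeiss.
Local Open Scope fset_scope.
Local Open Scope ring_scope.
Variables (R : realType) (G : groupType).
Implicit Types A B K F : {fset G}.

(** The inner [K]-boundary of [A]: outside it, the translate of [K] centred at a point of [A] stays
    in [A]. *)
Definition bad_core K A : {fset G} := [fset a in A | ~~ (fset_rmul K a `<=` A)].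

(** The outer [K]-boundary of [F]: the points [x] outside [F] for which [K x] meets [F]. *)
Definition outer_layer K F : {fset G} :=
  [fset x in [fset (k^-1 * y)%g | k in K, y in F] | x \notin F].

Lemma bad_coreS K K' A : K `<=` K' -> bad_core K A `<=` bad_core K' A.
Proof.
move=> /fsubsetP KK'; apply/fsubsetP => a; rewrite !inE => /andP[->] /=.
apply: contra => /fsubsetP h; apply/fsubsetP => x; rewrite in_fset_rmul => xK.
by apply: h; rewrite in_fset_rmul KK'.
Qed.

Lemma card_bad_core K F :
  (#|` bad_core K F| <= \sum_(k <- K) #|` fset_symdiff F (fset_lmul k F)|)%N.
Proof.
apply: (@leq_trans (\sum_(k <- K) #|` [fset a in F | (k * a)%g \notin F]|)).
  under [leqRHS]eq_bigr => k _ do rewrite card_fset_sep.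
  rewrite exchange_big/= card_fset_sep; apply: leq_sum => a _.
  case: (boolP (_ `<=` _)) => //= /fsubsetPn[x].
  rewrite in_fset_rmul => xK xF.
  by rewrite (big_fsetD1 (x * a^-1)%g)//= mulgVK xF.
apply: leq_sum => k _; rewrite -(card_fset_lmul _ k) fsubset_leq_card//.
apply/fsubsetP => x; rewrite !(in_fset_lmul, inE) mulVKg.
by move=> /andP[-> ->]; rewrite orbT.
Qed.

Lemma card_outer_layer K F :
  (#|` outer_layer K F| <= \sum_(k <- K) #|` fset_symdiff F (fset_lmul k F)|)%N.
Proof.
pose D k := [fset x in fset_lmul k^-1 F | x \notin F].
apply: (@leq_trans (\sum_(k <- K) #|` D k|)).
  elim/finSet_rect: K => K IH; have [->|[a aK]] := fset_0Vmem K.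
    rewrite big_seq_fset0 (_ : outer_layer _ _ = fset0) ?cardfs0//.
    apply/fsetP => x; rewrite !inE; apply/negbTE/negP => /andP[/imfset2P[k]].
    by rewrite inE.
  rewrite (big_fsetD1 a)//=.
  apply: leq_trans (leq_add (leqnn _) (IH _ (fproperD1 aK))).
  apply: leq_trans (leq_card_fsetU _ _); apply: fsubset_leq_card.
  apply/fsubsetP => x; rewrite !inE => /andP[/imfset2P[/= k kK [y yF ->]]] kyF.
  rewrite kyF !andbT; have [->|ka] := eqVneq k a.
    by rewrite in_fset_lmul invgK mulVKg yF.
  apply/orP; right; apply/imfset2P; exists k => //=; first by rewrite !inE ka.
  by exists y.
apply: leq_sum => k _; rewrite -(card_fset_lmul _ k) fsubset_leq_card//.
apply/fsubsetP => x; rewrite !(in_fset_lmul, inE) invgK mulVKg.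
by move=> /andP[-> ->].
Qed.

Variable h : {fset G} -> R.
Hypothesis h0 : h fset0 = 0.
Hypothesis h_mono : forall A B, A `<=` B -> h A <= h B.
Hypothesis h_sub : forall A B, h (A `|` B) <= h A + h B.
Hypothesis h_inv : forall A g, h (fset_rmul A g) = h A.

Let h_ge0 A : 0 <= h A.
Proof. by rewrite -h0 h_mono// fsub0set. Qed.

(* Greedy packing of [A] by translates of [F] that meet the part already packed
   in a proportion less than [e]; [l] lists the candidate centres. *)
Lemma greedy_packing K F A (e : R) (l : seq G) : 0 < e < 1 -> (1%g \in F) ->
  exists B, exists m : nat, [/\ B `<=` A, h B <= m%:R * h F,
    (1 - e) * #|` F|%:R * m%:R <= #|` B|%:R,
    (#|` [fset a in A | (a \notin B) && ~~ fdisjoint (fset_rmul K a) B]| <=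
       m * #|` outer_layer K F|)%N &
    forall c, c \in l -> fset_rmul F c `<=` A ->
      e * #|` F|%:R <= #|` fset_rmul F c `&` B|%:R].
Proof.
move=> /andP[e0 e1] F1; elim: l => [|c l [B [m [BA hB mB EB lB]]]].
  exists fset0, 0%N; split; rewrite ?fsub0set ?h0 ?mul0r ?mulr0 ?ler0n//.
  rewrite mul0n leqn0 cardfs_eq0; apply/eqP/fsetP => a; rewrite !inE.
  by rewrite fdisjointX0 andbF.
have [FcA|FcA] := boolP (fset_rmul F c `<=` A); last first.
  exists B, m; split => // c'; rewrite inE => /predU1P[->|]; last exact: lB.
  by rewrite (negbTE FcA).
have [eFc|eFc] := leP (e * #|` F|%:R) #|` fset_rmul F c `&` B|%:R.
  exists B, m; split => // c'; rewrite inE => /predU1P[->//|]; exact: lB.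
(* The translate [F c] meets [B] in fewer than [e #|F|] points, so packing it adds more than
   [(1 - e) #|F|] new ones; [m] counts the packed translates. *)
exists (B `|` fset_rmul F c), m.+1; split.
- by rewrite fsubUset BA.
- by rewrite -natr1 mulrDl mul1r (le_trans (h_sub _ _))// h_inv lerD2r.
- have /(congr1 (fun n : nat => n%:R : R)) := cardfsUI B (fset_rmul F c).
  rewrite !natrD card_fset_rmul fsetIC => UI.
  rewrite -natr1; lra.
- rewrite mulSn addnC; apply: leq_trans (leq_add EB (leqnn _)).
  rewrite -(card_fset_rmul (outer_layer K F) c).
  apply: leq_trans (leq_card_fsetU _ _); apply: fsubset_leq_card.
  apply/fsubsetP => a; rewrite !(in_fset_rmul, inE) negb_or => /and3P[aA /andP[aB aF]].
  rewrite aA aB aF fdisjointXU negb_and /= andbT => /orP[->//|/fdisjointP].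
  move=> nd; apply/orP; right; apply: contrapT => na; apply: nd => x.
  rewrite !in_fset_rmul => xK; apply/negP => xF; apply: na.
  apply/imfset2P; exists (x * a^-1)%g => //=; exists (x * c^-1)%g => //.
  by rewrite invgM invgK !mulgA mulgVK.
- move=> c'; rewrite inE => /predU1P[->|c'l] cA.
    by rewrite fsetIUr fsetIid (fsetUidPr _ _ (fsubsetIl _ _)) card_fset_rmul
      ler_piMl// ltW.
  by rewrite (le_trans (lB _ c'l cA))// ler_nat fsubset_leq_card// fsetIS// fsubsetUl.
Qed.

Lemma card_subadd_le A : h A <= #|` A|%:R * h [fset 1%g].
Proof.
elim/finSet_rect: A => A IH; have [->|[a aA]] := fset_0Vmem A.
  by rewrite h0 cardfs0 mul0r.
have {1}-> : A = [fset a] `|` A `\ a by rewrite fsetD1K.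
rewrite (le_trans (h_sub _ _))// (cardfsD1 a) aA natrD mulrDl mul1r.
rewrite lerD// ?IH ?fproperD1//.
rewrite -(h_inv _ a^-1) h_mono//; apply/fsubsetP => x.
rewrite in_fset_rmul !inE invgK => /eqP xa.
by apply/eqP/(mulIg a); rewrite xa mul1g.
Qed.

Variables (lam e : R).
Hypothesis lam0 : 0 <= lam.
Hypothesis e01 : 0 < e < 1.
Hypothesis lamP : forall K (d : R), 0 < d -> exists F, [/\ (1%g \in F),
  h F <= lam * #|` F|%:R & #|` outer_layer K F|%:R <= d * #|` F|%:R].

Let L := h [fset 1%g].

(** The error and the boundary are measured against a bound [M] for the size of [A], not against [A]
    itself: what a packing leaves over may be arbitrarily small, while [M] shrinks by a fixed factor
    at each step. *)
Definition almost_bound (rho : R) : Prop := exists K (d : R), 0 < d /\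
  forall A (M : R), #|` A|%:R <= M -> #|` bad_core K A|%:R <= d * M ->
    h A <= lam * #|` A|%:R / (1 - e) + rho * L * M.

Lemma almost_bound1 : almost_bound 1.
Proof.
exists fset0, 1; split => // A M AM _; rewrite mul1r (le_trans (card_subadd_le A))//.
apply: ler_wpDl.
  by rewrite mulr_ge0 ?invr_ge0 ?mulr_ge0// subr_ge0 ltW//; case/andP: e01.
by rewrite mulrC ler_wpM2l// /L.
Qed.

(** Pack [A] by translates of a set [F] on which [h] is at most [lam #|F|]. The packed part [B]
    costs at most [lam #|B| / (1 - e)], and the remainder is still nearly invariant and has size at
    most [(1 - e / 2) M], so the bound for [rho] applies to it. *)
Lemma almost_bound_step rho : 0 <= rho -> almost_bound rho ->
  almost_bound (rho * (1 - e / 2)).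
Proof.
move=> rho0 [K [d [d0 KdP]]]; case/andP: (e01) => e0 e1.
have L0 : 0 <= L := h_ge0 _.
have ne0 : 0 < 1 - e by rewrite subr_gt0.
have [|F [F1 hF oF]] := @lamP K ((1 - e) * (d / 4)).
  by rewrite mulr_gt0// divr_gt0.
(* The bound [1 / 2] leaves enough centres of translates of [F] inside [A]; the bound [d / 4] is
   half of the boundary allowance for the remainder. *)
exists (K `|` F), (Num.min (1 / 2) (d / 4)); split.
  by rewrite lt_min divr_gt0 //= divr_gt0.
move=> A M AM badA.
have M0 : 0 <= M by apply: le_trans AM; exact: ler0n.
have bK : #|` bad_core K A|%:R <= d / 4 * M.
  apply: (@le_trans _ _ #|` bad_core (K `|` F) A|%:R).
    by rewrite ler_nat fsubset_leq_card// bad_coreS// fsubsetUl.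
  by apply: (le_trans badA); rewrite ler_wpM2r// ge_min lexx orbT.
have bF : #|` bad_core F A|%:R <= 1 / 2 * M.
  apply: (@le_trans _ _ #|` bad_core (K `|` F) A|%:R).
    by rewrite ler_nat fsubset_leq_card// bad_coreS// fsubsetUr.
  by apply: (le_trans badA); rewrite ler_wpM2r// ge_min lexx.
have [B [m [BA hB mB EB lB]]] := @greedy_packing K F A e A e01 F1.
have F0 : 0 < #|` F|%:R :> R.
  by rewrite ltr0n cardfs_gt0; apply/fset0Pn; exists 1%g.
have cAB : #|` A `\` B|%:R = #|` A|%:R - #|` B|%:R :> R.
  by rewrite cardfsDS// natrB// fsubset_leq_card.
have BM : #|` B|%:R <= M.
  by apply: le_trans AM; rewrite ler_nat fsubset_leq_card.
(* By maximality of the packing, each centre [c] in [I] has at least [e #|F|] points of [F c] in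
   [B], while each point of [B] is counted at most [#|F|] times. *)
have eIB : e * (#|` A|%:R - #|` bad_core F A|%:R) <= #|` B|%:R.
  pose I := A `\` bad_core F A.
  have -> : #|` A|%:R - #|` bad_core F A|%:R = #|` I|%:R :> R.
    rewrite cardfsDS ?natrB// ?fsubset_leq_card//.
      by apply/fsubsetP => x; rewrite !inE => /andP[].
    by apply/fsubsetP => x; rewrite !inE => /andP[].
  rewrite -(ler_pM2r F0) mulrAC.
  apply: (@le_trans _ _ (\sum_(c <- I) #|` fset_rmul F c `&` B|)%N%:R).
    rewrite natr_sum (card_fset_sum1 I) natr_sum mulr_sumr big_seq [leRHS]big_seq.
    apply: ler_sum => c; rewrite !inE mulr1 => /andP[].
    by move=> + cA; rewrite cA/= negbK; exact: lB.
  rewrite sum_card_fset_rmulI -natrM ler_nat mulnC (card_fset_sum1 F) big_distrl/=.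
  by apply: leq_sum => k _; rewrite mul1n card_fset_preim_le.
(* A boundary point of the remainder is either one of [A], or its [K]-translate meets [B]. Each case
   accounts for at most [d / 4 * M] points, and [d / 2 <= d (1 - e / 2)]. *)
have bAB : #|` bad_core K (A `\` B)|%:R <= d * ((1 - e / 2) * M).
  apply: (@le_trans _ _ (d / 4 * M + m%:R * #|` outer_layer K F|%:R)).
    apply: le_trans (lerD bK (lexx _)); rewrite -natrM -natrD ler_nat.
    apply: leq_trans (leq_add (leqnn _) EB).
    apply: leq_trans (leq_card_fsetU _ _); apply: fsubset_leq_card.
    apply/fsubsetP => a; rewrite !inE => /andP[/andP[aB aA]].
    rewrite aA aB/= => /fsubsetPn[x xK]; rewrite inE negb_and negbK => /orP[xB|xA].
      apply/orP; right; apply/negP => /fdisjointP/(_ x xK).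
      by rewrite xB.
    apply/orP; left; apply/negP => /fsubsetP/(_ x xK).
    by apply/negP.
  have : m%:R * #|` outer_layer K F|%:R <= d / 4 * M.
    apply: (@le_trans _ _ (m%:R * ((1 - e) * (d / 4) * #|` F|%:R))).
      by rewrite ler_wpM2l.
    have -> : m%:R * ((1 - e) * (d / 4) * #|` F|%:R) =
        d / 4 * ((1 - e) * #|` F|%:R * m%:R) by ring.
    by rewrite ler_pM2l ?divr_gt0// (le_trans mB).
  have : 0 <= d * M * (1 - e) by rewrite !mulr_ge0// ltW.
  move=> p1 p2; lra.
have cAB' : #|` A `\` B|%:R <= (1 - e / 2) * M.
  rewrite cAB.
  have := ler_pM2l e0 (#|` bad_core F A|%:R) (1 / 2 * M); rewrite bF => p1.
  have : (1 - e) * #|` A|%:R <= (1 - e) * M by rewrite ler_pM2l.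
  lra.
have hAB := KdP _ _ cAB' bAB.
have AE : B `|` A `\` B = A by rewrite fsetUDl fsetDv fsetD0; exact/fsetUidPr.
have hA := h_sub B (A `\` B); rewrite AE in hA; apply: (le_trans hA).
have hB' : h B <= lam * #|` B|%:R / (1 - e).
  rewrite ler_pdivlMr//.
  apply: (@le_trans _ _ (m%:R * (lam * #|` F|%:R) * (1 - e))).
    by rewrite ler_pM2r// (le_trans hB)// ler_wpM2l.
  have -> : m%:R * (lam * #|` F|%:R) * (1 - e) =
      lam * ((1 - e) * #|` F|%:R * m%:R) by ring.
  by rewrite ler_wpM2l.
apply: (le_trans (lerD hB' hAB)).
by rewrite cAB le_eqVlt; apply/orP; left; apply/eqP; ring.
Qed.

Lemma almost_bound_small (eps : R) : 0 < eps -> exists rho : R,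
  [/\ 0 <= rho, rho <= eps & almost_bound rho].
Proof.
move=> eps0; case/andP: (e01) => e0 e1.
have q0 : 0 <= 1 - e / 2 by lra.
have ab n : almost_bound ((1 - e / 2) ^+ n).
  elim: n => [|n IH]; first exact: almost_bound1.
  by rewrite exprSr; apply: almost_bound_step => //; exact: exprn_ge0.
have /cvgrPdist_lt/(_ _ eps0)[n _ nP] : (1 - e / 2) ^+ n @[n --> \oo] --> (0 : R).
  by apply: cvg_expr; rewrite ger0_norm//; lra.
exists ((1 - e / 2) ^+ n); split => //; first exact: exprn_ge0.
have := nP n (leqnn _); rewrite sub0r normrN ger0_norm ?exprn_ge0//; exact: ltW.
Qed.

End OrnsteinWeiss.

(** * Existence of the limit along a Folner sequence *)

Section OrnsteinWeissLimit.
Variables (R : realType) (G : groupType).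
Local Open Scope fset_scope.
Local Open Scope ring_scope.
Implicit Types A B K : {fset G}.

Lemma card_folner_gt0 (F : nat -> {fset G}) n : folner R F -> 0 < #|` F n|%:R :> R.
Proof. by move=> [/(_ n) Fn0 _]; rewrite ltr0n cardfs_gt0. Qed.

Lemma folner_sum_symdiff (F : nat -> {fset G}) K (d : R) : folner R F -> 0 < d ->
  \forall n \near \oo,
    (\sum_(k <- K) #|` fset_symdiff (F n) (fset_lmul k (F n))|)%N%:R
      <= d * #|` F n|%:R.
Proof.
move=> fF d0; have [F0 Fk] := fF.
have : \sum_(k <- K) (#|` fset_symdiff (F n) (fset_lmul k (F n))|%:R / #|` F n|%:R : R)
    @[n --> \oo] --> (0 : R).
  elim: (enum_fset K) => [|k l IH].
    by under eq_cvg do rewrite big_nil; exact: cvg_cst.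
  under eq_cvg do rewrite big_cons.
  by have := cvgD (Fk k) IH; rewrite addr0; exact.
move=> /cvgrPdist_lt/(_ _ d0); apply: filterS => n.
rewrite sub0r normrN -mulr_suml -natr_sum => /(le_lt_trans (ler_norm _)).
by rewrite ltr_pdivrMr ?card_folner_gt0// => /ltW.
Qed.

(** The limit is the lower limit, written as the infimum of the levels [lam] that the sequence goes
    below infinitely often. *)
Lemma cvgn_of_frequently (a : nat -> R) (L : R) : (forall n, 0 <= a n <= L) ->
  (forall lam, 0 <= lam -> (forall N, exists2 n, (N <= n)%N & a n <= lam) ->
    forall eps, 0 < eps -> \forall n \near \oo, a n <= lam + eps) ->
  cvgn a.
Proof.
move=> aL freq.
pose S := [set lam : R | 0 <= lam /\ forall N, exists2 n, (N <= n)%N & a n <= lam].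
have SL : S L.
  split; first by case/andP: (aL 0%N) => a0; exact: le_trans.
  by move=> N; exists N => //; case/andP: (aL N).
have hS : has_inf S by split; [exists L|exists 0 => x []].
apply/cvg_ex; exists (inf S); apply/cvgrPdist_le => eps eps0.
have e20 : 0 < eps / 2 by rewrite divr_gt0.
have [lam [lam0 lamf] lamS] := inf_adherent e20 hS.
have lb : \forall n \near \oo, inf S - eps <= a n.
  have [ie|ie] := ltP (inf S - eps) 0.
    by near=> n; case/andP: (aL n) => a0 _; rewrite (le_trans (ltW ie)).
  have nS : ~ S (inf S - eps).
    move=> /(ge_inf hS.2); lra.
  have : ~ forall N, exists2 n, (N <= n)%N & a n <= inf S - eps.
    by move=> H; apply: nS.
  move/existsNP => [N /forall2NP HN]; exists N => // n /= Nn.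
  by have [//|] := HN n; move/negP; rewrite -ltNge => /ltW.
move: (freq _ lam0 lamf _ e20) lb; apply: filterS2 => n h1 h2.
rewrite ler_norml; apply/andP; split; lra.
Unshelve. all: end_near. Qed.

Variable h : {fset G} -> R.
Hypothesis h0 : h fset0 = 0.
Hypothesis h_mono : forall A B, A `<=` B -> h A <= h B.
Hypothesis h_sub : forall A B, h (A `|` B) <= h A + h B.
Hypothesis h_inv : forall A g, h (fset_rmul A g) = h A.

Theorem ornstein_weiss (F : nat -> {fset G}) : folner R F ->
  cvgn (fun n => #|` F n|%:R^-1 * h (F n)).
Proof.
move=> fF; have [F0 Fk] := fF.
have h_ge0 A : 0 <= h A by rewrite -h0 h_mono// fsub0set.
pose L := h [fset 1%g].
apply: (@cvgn_of_frequently _ L) => [n|lam lam0 lamf eps eps0].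
  rewrite mulr_ge0 ?invr_ge0//= mulrC ler_pdivrMr ?card_folner_gt0// mulrC.
  exact: card_subadd_le.
(* With this [e], [lam / (1 - e) <= lam + eps / 2]; the other half of [eps] is spent on
   [rho * L]. *)
pose e : R := Num.min (1 / 2) (eps / (4 * (lam + 1))).
have e01 : 0 < e < 1.
  rewrite /e lt_min gt_min; apply/andP; split; last by apply/orP; left; lra.
  by rewrite divr_gt0//= divr_gt0// mulr_gt0// ltr_wpDl.
have lamP K (d : R) : 0 < d -> exists F, [/\ (1%g \in F),
    h F <= lam * #|` F|%:R & #|` outer_layer K F|%:R <= d * #|` F|%:R].
  move=> d0; have [N _ NP] := folner_sum_symdiff K fF d0.
  have [n Nn an] := lamf N; have /fset0Pn[g gF] := F0 n.
  (* A right translation brings the identity into the Folner set and changes neither [h] nor the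
     cardinalities of the set and of its outer layer. *)
  exists (fset_rmul (F n) g^-1); rewrite card_fset_rmul h_inv; split.
  - by rewrite in_fset_rmul invgK mul1g.
  - by rewrite -ler_pdivrMr ?card_folner_gt0// mulrC.
  - apply: le_trans (NP n Nn); rewrite ler_nat.
    apply: (leq_trans (card_outer_layer _ _)); apply: leq_sum => k _.
    rewrite -[leqRHS](card_fset_rmul _ g^-1) fsubset_leq_card//.
    by apply/fsubsetP => x; rewrite !(in_fset_rmul, in_fset_lmul, inE) !mulgA.
have L0 : 0 <= L := h_ge0 _.
have [|rho [rho0 rhoL [K [d [d0 KdP]]]]] := almost_bound_small h0 h_mono h_sub
    h_inv lam0 e01 lamP (_ : 0 < eps / (2 * (L + 1))).
  by rewrite divr_gt0// mulr_gt0// ltr_wpDl.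
have := folner_sum_symdiff K fF d0; apply: filterS => n nP.
rewrite mulrC ler_pdivrMr ?card_folner_gt0//.
apply: (le_trans (KdP _ #|` F n|%:R (lexx _) _)).
  by apply: le_trans nP; rewrite ler_nat card_bad_core.
rewrite mulrAC -mulrDl ler_pM2r ?card_folner_gt0//.
case/andP: e01 => e0 e1.
have p1 : lam / (1 - e) <= lam + eps / 2.
  rewrite ler_pdivrMr ?subr_gt0//.
  have e2 : e <= 1 / 2 by rewrite /e ge_min lexx.
  have e3 : e * (4 * (lam + 1)) <= eps.
    by rewrite -ler_pdivlMr ?mulr_gt0 ?ltr_wpDl// /e ge_min lexx orbT.
  have e4 : 0 <= eps * (1 / 2 - e) by apply: mulr_ge0; lra.
  lra.
have p2 : rho * L <= eps / 2.
  have : rho * (2 * (L + 1)) <= eps by rewrite -ler_pdivlMr// mulr_gt0// ltr_wpDl.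
  lra.
by apply: (le_trans (lerD p1 p2)); lra.
Qed.
End OrnsteinWeissLimit.

Lemma leq_exp2r_weak m n k : (m <= n)%N -> (m ^ k <= n ^ k)%N.
Proof. by move=> mn; elim: k => // k IH; rewrite !expnS leq_mul. Qed.

(** * A Sauer-Shelah lemma for partial patterns *)

Section Shattering.
Variables (X : Type) (T : finType) (K : 'I_2 -> T -> set X).
Hypothesis Kdisj : forall i j z x, K i z x -> K j z x -> i = j.
Implicit Types (E : set X) (D J : {set T}).

Definition shattered E J : Prop :=
  forall s : {ffun T -> 'I_2}, exists2 x, E x & forall z, z \in J -> K (s z) z x.

Definition shat E D : {set {set T}} :=
  [set J : {set T} | (J \subset D) && `[< shattered E J >]]%SET.

Definition upd (z : T) (i : 'I_2) (t : {ffun T -> 'I_2}) : {ffun T -> 'I_2} :=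
  [ffun w => if w == z then i else t w].

Lemma shatS E E' D D' : E `<=` E' -> D \subset D' -> shat E D \subset shat E' D'.
Proof.
move=> EE' DD'; apply/fintype.subsetP => J; rewrite !inE => /andP[JD /asboolP sJ].
rewrite (fintype.subset_trans JD DD')/=; apply/asboolP => s.
by have [x Ex xP] := sJ s; exists x => //; exact: EE'.
Qed.

Lemma ord2_neq (i j k : 'I_2) : i != j -> k = i \/ k = j.
Proof.
by case: i j k => [[|[]]] // ? [[|[]]] // ? [[|[]]] // ? _;
  (by left; exact: val_inj) || (by right; exact: val_inj).
Qed.

(** A set [J] counted on the left is shattered by [E]; if it is counted twice, then [z |: J] is
    shattered as well, since both values at [z] are available. *)
Lemma card_shat_split E D z i j : z \in D -> i != j ->
  (#|shat (E `&` K i z) (D :\ z)%SET| + #|shat (E `&` K j z) (D :\ z)%SET|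
   <= #|shat E D|)%N.
Proof.
move=> zD ij; set A := shat (E `&` K i z) _; set B := shat (E `&` K j z) _.
rewrite -cardsUI.
have AB_z J : J \in (A :|: B)%SET -> z \notin J.
  by rewrite !inE => /orP[] /andP[/fintype.subsetP JD _]; apply/negP => /JD; rewrite !inE eqxx.
have inj : {in (A :&: B)%SET &, injective (fun J => z |: J)%SET}.
  move=> J J' /setIP[JA _] /setIP[J'A _] e.
  have zJ : z \notin J by apply: AB_z; rewrite finset.in_setU JA.
  have zJ' : z \notin J' by apply: AB_z; rewrite finset.in_setU J'A.
  by rewrite -(finset.setU1K zJ) e finset.setU1K.
rewrite -(card_in_imset inj) -cardsUI.
have -> : ((A :|: B) :&: [set z |: J | J in A :&: B] = finset.set0)%SET.
  apply/finset.setP => J; rewrite finset.in_setI finset.in_set0; apply/negbTE/negP => /andP[+ /imsetP[J' _ e]].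
  by move=> /(AB_z J)/negP; apply; rewrite e !inE eqxx.
rewrite cards0 addn0; apply: fintype.subset_leq_card; apply/fintype.subsetP => J.
rewrite finset.in_setU => /orP[|/imsetP[J' + ->]].
  rewrite finset.in_setU => /orP[]; apply/fintype.subsetP/shatS => //; exact: finset.subsetDl.
rewrite !inE => /andP[/andP[JD /asboolP sA] /andP[_ /asboolP sB]].
rewrite finset.subUset finset.sub1set zD (fintype.subset_trans JD (finset.subsetDl _ _))/=.
apply/asboolP => s; have [sz|sz] := ord2_neq (s z) ij.
  have [x [Ex Kx] xP] := sA s; exists x => // w; rewrite !inE => /orP[/eqP->|/xP//].
  by rewrite sz.
have [x [Ex Kx] xP] := sB s; exists x => // w; rewrite !inE => /orP[/eqP->|/xP//].
by rewrite sz.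
Qed.

(* Pajor's form of the Sauer-Shelah lemma, for partially defined patterns: the
   point [x] takes the value [i] at [z] when [K i z x], and may have no value. *)
Lemma cover_le_shat k D E : exists L : seq {ffun T -> 'I_2},
  (forall x, E x -> exists2 t, t \in L & forall z, z \in D -> ~ K (t z) z x) /\
  (size L * 2 ^ (k * #|D|) <= (2 ^ k).+1 ^ #|D| * #|shat E D| ^ k)%N.
Proof.
move: {2}#|D| (leqnn #|D|) => n; elim: n => [|n IH] in D E *.
  rewrite leqn0 cards_eq0 => /eqP->; rewrite cards0.
  have [[x Ex]|E0] := pselect (exists x, E x); last first.
    by exists [::]; split => // x Ex; case: E0; exists x.
  exists [:: [ffun=> ord0]]; split.
    by move=> y _; exists [ffun=> ord0]; rewrite ?inE// => z; rewrite inE.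
  rewrite muln0 !expn0 !mul1n expn_gt0; apply/orP; left.
  apply/card_gt0P; exists finset.set0; rewrite inE finset.sub0set; apply/asboolP => s.
  by exists x => // z; rewrite inE.
have [->|[z zD]] := set_0Vmem D; first by move=> _; apply: IH; rewrite cards0.
rewrite (cardsD1 z) zD add1n ltnS => Dn.
(* The value [i] is the one whose class shatters fewer sets, hence at most half of [shat E D].
   Points with value [i] at [z] are avoided by [j] there, at the cost of a fraction [2 ^- k] of the
   bound; all other points are avoided by [i], at full cost. This gives the factor [1 + 2 ^- k]. *)
have [i [j [ij sij]]] : exists i j, i != j /\
    (#|shat (E `&` K i z) (D :\ z)%SET| <= #|shat (E `&` K j z) (D :\ z)%SET|)%N.
  have [h|h] := leqP #|shat (E `&` K ord0 z) (D :\ z)%SET|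
                     #|shat (E `&` K ord_max z) (D :\ z)%SET|.
    by exists ord0, ord_max.
  by exists ord_max, ord0; split => //; exact: ltnW.
have [L1 [L1P L1s]] := IH _ (E `&` K i z) Dn.
have [L2 [L2P L2s]] := IH _ (E `\` K i z) Dn.
exists (map (upd z j) L1 ++ map (upd z i) L2); split.
  move=> x Ex; have [Kx|Kx] := pselect (K i z x).
    have [t tL tP] := L1P x (conj Ex Kx).
    exists (upd z j t); first by rewrite mem_cat map_f.
    move=> w wD; rewrite ffunE; have [->|wz] := eqVneq w z.
      by move=> Kj; move/eqP: ij; apply; exact: Kdisj Kx Kj.
    by apply: tP; rewrite !inE wz.
  have [t tL tP] := L2P x (conj Ex Kx).
  exists (upd z i t); first by rewrite mem_cat map_f ?orbT.
  move=> w wD; rewrite ffunE; have [->//|wz] := eqVneq w z.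
  by apply: tP; rewrite !inE wz.
rewrite size_cat !size_map.
have split_le := card_shat_split E zD ij.
set s := #|shat E D| in split_le *; set s1 := #|shat (E `&` K i z) _| in sij split_le L1s.
set s2 := #|shat (E `\` K i z) _| in L2s.
have s2s : (s2 <= s)%N.
  by apply/fintype.subset_leq_card/shatS; [exact: subDsetl|exact: finset.subsetDl].
have s1s : ((2 * s1) ^ k <= s ^ k)%N by apply: leq_exp2r_weak; lia.
have s2s' : (s2 ^ k <= s ^ k)%N by apply: leq_exp2r_weak.
set n' := #|_| in L1s L2s *.
rewrite mulnS expnD expnS mulnCA mulnDl mulnDr.
rewrite expnMn in s1s.
have l1 : (2 ^ k * (size L1 * 2 ^ (k * n')) <= (2 ^ k).+1 ^ n' * s ^ k)%N.
  apply: leq_trans (leq_mul (leqnn _) L1s) _; rewrite mulnCA.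
  exact: leq_mul.
have l2 : (2 ^ k * (size L2 * 2 ^ (k * n')) <= 2 ^ k * ((2 ^ k).+1 ^ n' * s ^ k))%N.
  by apply: leq_mul => //; apply: (leq_trans L2s); exact: leq_mul.
by apply: (leq_trans (leq_add l1 l2)); rewrite -mulSn mulnA.
Qed.

End Shattering.

(** * Exponential covering numbers force large shattered sets *)

Section LargeShattered.
Variable R : realType.

Lemma sum_subsets_expr (T : finType) (x : R) :
  \sum_(J : {set T}) x ^+ #|J| = (x + 1) ^+ #|T|.
Proof.
rewrite exprD1n (partition_big (fun J : {set T} => inord #|J| : 'I_#|T|.+1) xpredT)//=.
apply: eq_bigr => i _.
rewrite (eq_bigl (fun J : {set T} => J \in [set J : {set T} | #|J| == i]%SET)); last first.
  by move=> J; rewrite inE -val_eqE/= inordK// ltnS max_card.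
rewrite (eq_bigr (fun=> x ^+ i)); last by move=> J; rewrite inE => /eqP->.
by rewrite sumr_const card_draws.
Qed.

(** A Chernoff bound: each small [J] has [x ^+ d <= x ^+ #|J|], and the sum of [x ^+ #|J|] over all
    subsets is given by the binomial theorem. *)
Lemma card_small_subsets (T : finType) (x : R) (d : nat) (A : {set {set T}}) :
  0 < x <= 1 -> (forall J, J \in A -> (#|J| <= d)%N) ->
  #|A|%:R * x ^+ d <= (x + 1) ^+ #|T|.
Proof.
move=> /andP[x0 x1] Ad; rewrite -sum_subsets_expr mulr_natl -sumr_const.
rewrite [leRHS](bigID (mem A))/= ler_wpDr//.
  by apply: sumr_ge0 => J _; rewrite exprn_ge0// ltW.
by apply: ler_sum => J /Ad Jd; rewrite ler_wiXn2l// ltW.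
Qed.

Lemma exists_large_shattered (c : R) : 0 < c -> exists2 delta : R, 0 < delta &
  forall (X : Type) (T : finType) (K : 'I_2 -> T -> set X) (E : set X),
  (0 < #|T|)%N -> (forall i j z x, K i z x -> K j z x -> i = j) ->
  (forall L : seq {ffun T -> 'I_2},
    (forall x, E x -> exists2 t, t \in L & forall z, ~ K (t z) z x) ->
    expR (c * #|T|%:R) <= (size L)%:R) ->
  exists2 J : {set T}, shattered K E J & delta * #|T|%:R <= #|J|%:R.
Proof.
(* The logarithm of the size of the list is at most [n 2 ^- k + k (n x + d q)]. The choices of [k],
   of [x = expR (- q)] and of [delta] bound the three terms by [c n / 3], [c n / 3] and [c n / 4],
   whose sum is less than [c n]. *)
move=> c0; pose k := (Num.truncn (3 / c)).+1.
have k0 : 0 < k%:R :> R by rewrite ltr0n.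
have kc : 3 / c <= k%:R by apply/ltW/truncnS_gt.
pose q : R := 3 * k%:R / c.
have q0 : 0 < q by rewrite divr_gt0// mulr_gt0.
pose x := expR (- q); have x0 : 0 < x by rewrite expR_gt0.
have x1 : x <= 1 by rewrite -[leRHS]expR0 ler_expR lerNl oppr0 ltW.
have xk : x * k%:R <= c / 3.
  rewrite /x expRN mulrC ler_pdivrMr ?expR_gt0//.
  apply: (@le_trans _ _ (c / 3 * q)).
    by rewrite /q le_eqVlt; apply/orP; left; apply/eqP; field; rewrite gt_eqF.
  rewrite ler_pM2l ?divr_gt0//; apply: le_trans (expR_ge1Dx _).
  by rewrite lerDr.
pose delta := c / (4 * k%:R * q).
have delta0 : 0 < delta.
  by apply: divr_gt0 => //; apply: mulr_gt0 => //; apply: mulr_gt0.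
exists delta => // X T K E T0 Kd Lbig; apply: contrapT => noJ.
have noJ2 J : shattered K E J -> #|J|%:R < delta * #|T|%:R.
  by move=> sJ; rewrite ltNge; apply/negP => dJ; apply: noJ; exists J.
have [L [LP Ls]] := @cover_le_shat X T K Kd k [set: T]%SET E.
have {}Lbig : expR (c * #|T|%:R) <= (size L)%:R.
  by apply: Lbig => y /LP[t tL tP]; exists t => // z; apply: tP; rewrite inE.
rewrite cardsT in Ls; set n := #|T| in T0 noJ2 Ls Lbig *; set s := #|shat _ _ _| in Ls.
have n0 : 0 < n%:R :> R by rewrite ltr0n.
have dn0 : 0 <= delta * n%:R by rewrite mulr_ge0// ltW.
pose d := Num.truncn (delta * n%:R).
have dn : d%:R <= delta * n%:R by rewrite truncn_le.
have sd : s%:R * x ^+ d <= (x + 1) ^+ n.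
  apply: card_small_subsets; first by rewrite x0.
  move=> J; rewrite inE => /andP[_ /asboolP/noJ2/ltW Jd].
  by rewrite /d truncn_ge_nat.
have sE : s%:R <= expR (n%:R * x + d%:R * q).
  rewrite expRD -ler_pdivrMr ?expR_gt0// -expRN -mulrN !expRM_natl.
  apply: (le_trans sd).
  apply: lerXn2r; [by rewrite nnegrE addr_ge0// ltW|by rewrite nnegrE expR_ge0|].
  by rewrite addrC expR_ge1Dx.
have {}Ls : (size L)%:R <= (1 + 2 ^- k) ^+ n * s%:R ^+ k :> R.
  move: Ls; rewrite -(ler_nat R) !natrM !natrX => Ls.
  have p2 : 0 < 2 ^+ (k * n) :> R by rewrite exprn_gt0.
  rewrite -(ler_pM2r p2); apply: (le_trans Ls).
  rewrite -natr1 natrX exprM mulrAC -exprMn mulrDl mul1r mulVf ?gt_eqF ?exprn_gt0//.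
have k2 : 2 ^- k <= c / 3 :> R.
  rewrite invf_ple ?posrE ?divr_gt0 ?exprn_gt0// invf_div (le_trans kc)//.
  by rewrite -natrX ler_nat ltnW// ltn_expl.
have : (size L)%:R <= expR (n%:R * (c / 3) + k%:R * (n%:R * x + d%:R * q)).
  apply: (le_trans Ls); rewrite expRD !expRM_natl.
  apply: ler_pM; rewrite ?exprn_ge0 ?addr_ge0 ?invr_ge0 ?exprn_ge0//.
    apply: lerXn2r; rewrite ?nnegrE ?addr_ge0 ?invr_ge0 ?exprn_ge0 ?expR_ge0//.
    by apply: le_trans (expR_ge1Dx _); rewrite lerD2l.
  by apply: lerXn2r; rewrite ?nnegrE ?expR_ge0.
move=> /(le_trans Lbig); rewrite ler_expR; apply/negP; rewrite -ltNge.
have l1 : k%:R * (n%:R * x) <= n%:R * (c / 3).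
  by rewrite mulrCA ler_pM2l// mulrC.
have l2 : k%:R * (d%:R * q) <= n%:R * (c / 4).
  rewrite mulrCA; apply: (@le_trans _ _ (delta * n%:R * (k%:R * q))).
    by apply: ler_wpM2r => //; apply/ltW/mulr_gt0.
  rewrite /delta le_eqVlt; apply/orP; left; apply/eqP; field.
  by rewrite !gt_eqF.
have : 0 < c * n%:R by rewrite mulr_gt0.
lra.
Qed.

End LargeShattered.

(** * Families of finite sets of positive density along a Folner sequence *)

Section DensityAlongFolner.
Variables (R : realType) (G : groupType) (F : nat -> {fset G}).
Local Open Scope fset_scope.
Local Open Scope ring_scope.
Hypothesis fF : folner R F.

Definition dense_along (P : {fset G} -> Prop) : Prop := exists2 c : R, 0 < c &
  \forall n \near \oo, exists J, [/\ J `<=` F n, P J & c * #|` F n|%:R <= #|` J|%:R].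

Definition hereditary (P : {fset G} -> Prop) : Prop :=
  forall A B, A `<=` B -> P B -> P A.

Definition translation_invariant (P : {fset G} -> Prop) : Prop :=
  forall A g, P A -> P (fset_rmul A g).

Lemma dense_along_true : dense_along (fun=> True).
Proof. by exists 1 => //; near=> n; exists (F n); rewrite mul1r.
Unshelve. all: end_near. Qed.

(* Averaging over the translates of a dense set in [F n] inside a much larger
   [F m] yields one that meets a dense set of [F m] in the expected proportion. *)
Lemma dense_alongI P Q : hereditary P -> translation_invariant P -> hereditary Q ->
  dense_along P -> dense_along Q -> dense_along (fun J => P J /\ Q J).
Proof.
move=> hP tP hQ [c c0 dP] [d d0 dQ]; exists (c * d / 2).
  by rewrite divr_gt0// mulr_gt0.
move: dQ; apply: filterS => n [J2 [J2F QJ2 cJ2]].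
have [m [[J1 [J1F PJ1 cJ1]] sm]] : exists m,
    (exists J, [/\ J `<=` F m, P J & c * #|` F m|%:R <= #|` J|%:R]) /\
    (\sum_(k <- F n) #|` fset_symdiff (F m) (fset_lmul k (F m))|)%N%:R
      <= 1 * #|` F m|%:R :> R.
  have [m0 _ mP] := filterI dP (folner_sum_symdiff (F n) fF (@ltr01 R)).
  by exists m0; apply: (mP m0) => /=.
(* [T] contains every [t] for which [J2 t] meets [J1], so no intersection is lost in the sum over
   [T], and its size is at most twice that of [F m]. *)
pose T := F m `|` outer_layer (F n) (F m).
have Fm0 := card_folner_gt0 m fF.
have T2 : #|` T|%:R <= 2 * #|` F m|%:R :> R.
  rewrite mulr_natl mulr2n; apply: (@le_trans _ _ (#|` F m| + #|` outer_layer (F n) (F m)|)%N%:R).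
    by rewrite ler_nat leq_card_fsetU.
  rewrite natrD lerD2l; rewrite mul1r in sm.
  by apply: le_trans sm; rewrite ler_nat card_outer_layer.
have T0 : 0 < #|` T|%:R :> R.
  by apply: (lt_le_trans Fm0); rewrite ler_nat fsubset_leq_card// fsubsetUl.
have : (\sum_(t <- T) #|` fset_rmul J2 t `&` J1| = #|` J2| * #|` J1|)%N.
  rewrite sum_card_fset_rmulI (card_fset_sum1 J2) big_distrl/= big_seq [RHS]big_seq.
  apply: eq_bigr => k kJ2; rewrite mul1n -(card_fset_lmul J1 k^-1).
  congr (#|` _|); apply/fsetP => x; rewrite !(in_fset_lmul, inE) invgK.
  case kx : (k * x \in J1)%g; rewrite ?andbF// andbT.
  case xF : (x \in F m) => //=; rewrite andbT; apply/imfset2P.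
  exists k; first by move/fsubsetP: J2F; exact.
  by exists (k * x)%g; [move/fsubsetP: J1F; exact|rewrite mulKg].
move=> sumT.
have [t tT] : exists2 t, t \in T &
    #|` J2|%:R * #|` J1|%:R <= #|` T|%:R * #|` fset_rmul J2 t `&` J1|%:R :> R.
  apply: contrapT => nt.
  suff : (\sum_(t <- T) #|` fset_rmul J2 t `&` J1|)%:R * #|` T|%:R <
      (#|` J2| * #|` J1|)%:R * #|` T|%:R :> R by rewrite sumT ltxx.
  have lt t : t \in T -> #|` fset_rmul J2 t `&` J1|%:R * #|` T|%:R <
      #|` J2|%:R * #|` J1|%:R :> R.
    by move=> tT; rewrite ltNge (mulrC #|` _ `&` _|%:R); apply/negP => le; apply: nt; exists t.
  have -> : (#|` J2| * #|` J1|)%:R * #|` T|%:R = \sum_(t <- T) (#|` J2|%:R * #|` J1|%:R) :> R.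
    rewrite natrM (card_fset_sum1 T) natr_sum mulr_sumr.
    by apply: eq_bigr => ? _; rewrite mulr1.
  rewrite natr_sum mulr_suml big_seq [ltRHS]big_seq; apply: ltr_sum.
    rewrite ltr0n cardfs_gt0 in T0; case/fset0Pn: T0 => t tT.
    by apply/hasP; exists t.
  by move=> t tT; rewrite lt.
move=> tle; exists (fset_rmul (fset_rmul J2 t `&` J1) t^-1); split.
- apply/fsubsetP => x; rewrite !(in_fset_rmul, inE) invgK mulgK => /andP[xJ _].
  by move/fsubsetP: J2F; exact.
- split.
    apply: (hP _ (fset_rmul J1 t^-1)); last exact: tP.
    by apply/fsubsetP => x; rewrite !(in_fset_rmul, inE) => /andP[].
  apply: hQ QJ2; apply/fsubsetP => x; rewrite !(in_fset_rmul, inE) invgK mulgK.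
  by case/andP.
- rewrite card_fset_rmul; set i := #|` _ `&` _|%:R in tle *.
  have p1 : c * #|` F m|%:R * (d * #|` F n|%:R) <= #|` J1|%:R * #|` J2|%:R.
    by apply: ler_pM => //; apply: mulr_ge0 => //; exact: ltW.
  have p2 : #|` T|%:R * i <= 2 * #|` F m|%:R * i.
    by apply: ler_wpM2r => //; exact: ler0n.
  rewrite -(ler_pM2l Fm0); lra.
Qed.

Lemma dense_along_forall (I : finType) (P : I -> {fset G} -> Prop) :
  (forall i, hereditary (P i)) -> (forall i, translation_invariant (P i)) ->
  (forall i, dense_along (P i)) -> dense_along (fun J => forall i, P i J).
Proof.
move=> hP tP dP.
suff [c c0 h] : dense_along (fun J => forall i, i \in enum I -> P i J).
  exists c => //; apply: filterS h => n [J [JF PJ cJ]]; exists J; split => // i.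
  by apply: PJ; rewrite mem_enum.
elim: (enum I) => [|i l IH].
  have [c c0 h] := dense_along_true.
  by exists c => //; apply: filterS h => n [J [JF _ cJ]]; exists J.
have hQ : hereditary (fun J => forall i, i \in l -> P i J).
  by move=> A B AB PB j jl; apply: hP (PB j jl).
have [c c0 h] := dense_alongI (hP i) (tP i) hQ (dP i) IH.
exists c => //; apply: filterS h => n [J [JF [Pi Pl] cJ]]; exists J; split => // j.
by rewrite inE => /predU1P[->|/Pl].
Qed.

End DensityAlongFolner.

(** * Minimal subcovers *)

Section CoveringNumbers.
Variables (Z : topologicalType) (I : finType) (U : I -> set Z).

Lemma covnum_le (E : set Z) (A : {set I}) :
  E `<=` \bigcup_(i in [set` A]) U i -> (covnum U E <= #|A|)%N.
Proof.
move=> EA; rewrite /covnum.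
have : A \in index_enum {set I} by rewrite mem_index_enum.
elim: (index_enum _) => // B l IH; rewrite inE big_cons => /predU1P[<-|/IH h].
  by rewrite asboolT// geq_minl.
by case: ifP => // _; rewrite geq_min h orbT.
Qed.

Lemma covnum_attained (E : set Z) : E `<=` \bigcup_i U i ->
  exists2 A : {set I}, E `<=` \bigcup_(i in [set` A]) U i & covnum U E = #|A|.
Proof.
move=> EU; rewrite /covnum.
pose Q n := exists2 A : {set I}, E `<=` \bigcup_(i in [set` A]) U i & n = #|A|.
apply: (big_ind Q) => [|m n Qm Qn|A /asboolP EA].
- exists [set: I]%SET; last by rewrite cardsT.
  by move=> z /EU[i _ Uz]; exists i => //=; rewrite inE.
- by rewrite /minn; case: ifP.
- by exists A.
Qed.

End CoveringNumbers.

(** * Existence and positivity of the relative entropy *)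

Section RelativeEntropy.
Variables (R : realType) (G : groupType) (Z W : topologicalType).
Variables (aZ : gaction G Z) (aW : gaction G W) (p : Z -> W) (z0 : Z).
Hypothesis p_equiv : forall g z, p (aZ g z) = aW g (p z).
Variable U : 'I_2 -> set Z.
Hypothesis Ucov : \bigcup_i U i = [set: Z].

(** The elements of the joined cover are named by functions on all of [G], so that unions and
    translates of [F] can be treated without changing the type of the names. *)
Definition has_cover (F : {fset G}) (E : set Z) (N : nat) : Prop :=
  exists (J : finType) (t : J -> G -> 'I_2), (#|J| <= N)%N /\
    forall z, E z -> exists j, forall g, g \in F -> U (t j g) (aZ g z).

Local Notation fiber y := (p @^-1` [set y]).

Lemma join_cover_covers (F : {fset G}) : \bigcup_s @join_cover G Z aZ _ U F s = [set: Z].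
Proof.
apply/seteqP; split => // z _.
have /(_ _)/cid-/all_sig[t tP] g : exists i, U i (aZ g z).
  by have : [set: Z] (aZ g z) by []; rewrite -Ucov => -[i _]; exists i.
by exists [ffun g : F => t (\val g)] => // g _; rewrite /= ffunE.
Qed.

Lemma covnum_join_cover (F : {fset G}) (E : set Z) N :
  (covnum (@join_cover G Z aZ _ U F) E <= N)%N <-> has_cover F E N.
Proof.
split=> [|[J [t [JN tP]]]].
  have [|A EA ->] := @covnum_attained _ _ (@join_cover G Z aZ _ U F) E.
    by rewrite join_cover_covers.
  move=> AN; pose ext (s : {ffun F -> 'I_2}) g := if insub g is Some g' then s g' else ord0.
  exists {s | s \in A}, (fun s => ext (\val s)); rewrite card_sig; split => //.
  move=> z /EA[s /= sA sz]; exists (Sub s sA) => g gF /=.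
  by rewrite /ext insubT; exact: (sz [` gF]%fset).
pose A := [set [ffun g : F => t j (\val g)] | j in J]%SET.
apply: (leq_trans (@covnum_le _ _ _ _ A _)).
  move=> z /tP[j jP]; exists [ffun g : F => t j (\val g)] => /=.
    by apply/imsetP; exists j.
  by move=> g _; rewrite /= ffunE; apply: jP; exact: valP.
by apply: leq_trans JN; rewrite (leq_trans (leq_imset_card _ _))// max_card.
Qed.

Lemma has_coverM (A B : {fset G}) E m n : has_cover A E m -> has_cover B E n ->
  has_cover (A `|` B)%fset E (m * n).
Proof.
move=> [J [t [Jm tP]]] [J' [t' [Jn tP']]].
exists (J * J')%type, (fun j g => if g \in A then t j.1 g else t' j.2 g).
rewrite card_prod leq_mul//; split => // z Ez.
have [[j jP] [j' jP']] := (tP z Ez, tP' z Ez).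
exists (j, j') => g; rewrite inE /=; case: ifP => [gA _|_ gB]; first exact: jP.
exact: jP'.
Qed.

Lemma has_coverS (A B : {fset G}) E m n : (A `<=` B)%fset -> (m <= n)%N ->
  has_cover B E m -> has_cover A E n.
Proof.
move=> /fsubsetP AB mn [J [t [Jm tP]]]; exists J, t; split; first exact: leq_trans mn.
by move=> z /tP[j jP]; exists j => g /AB; exact: jP.
Qed.

(** The action of [g] maps the fibre of [y] into the fibre of [g y]. Since all fibres enter the
    supremum, this yields the right invariance needed for the Ornstein-Weiss lemma. *)
Lemma has_cover_rmul (A : {fset G}) g y m : has_cover A (fiber (aW g y)) m ->
  has_cover (fset_rmul A g) (fiber y) m.
Proof.
move=> [J [t [Jm tP]]]; exists J, (fun j x => t j (x * g^-1)%g); split => // z yz.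
have [j jP] : exists j, forall x, x \in A -> U (t j x) (aZ x (aZ g z)).
  by apply: tP; rewrite /= p_equiv yz.
exists j => x; rewrite in_fset_rmul => /jP; rewrite -gactM mulgVK; exact.
Qed.

Lemma has_cover_gt0 A z n : has_cover A (fiber (p z)) n -> (0 < n)%N.
Proof.
move=> [J [t [Jn /(_ z)[]]]] // j _; apply: leq_trans Jn.
by apply/card_gt0P; exists j.
Qed.

(** Covering numbers are natural numbers bounded by the number of patterns on [A], so the supremum
    over the fibres is attained; the fibre of [p z0] makes it positive. *)
Lemma rel_covnumP (A : {fset G}) : exists N : nat, [/\
  rel_covnum R p (@join_cover G Z aZ _ U A) = N%:R, (0 < N)%N,
  forall y, has_cover A (fiber y) N &
  exists y, forall n, has_cover A (fiber y) n -> (N <= n)%N].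
Proof.
pose f y := covnum (@join_cover G Z aZ _ U A) (fiber y).
have fM y : (f y <= #|{ffun A -> 'I_2}|)%N.
  rewrite -cardsT; apply: covnum_le => z _.
  have : [set: Z] z by []; rewrite -(join_cover_covers A) => -[s _ sz].
  by exists s => //=; rewrite inE.
have exf : exists n, `[< exists y, f y = n >].
  by exists (f (p z0)); apply/asboolP; exists (p z0).
have fM' n : `[< exists y, f y = n >] -> (n <= #|{ffun A -> 'I_2}|)%N.
  by move=> /asboolP[y <-].
case: (ex_maxnP exf fM') => N /asboolP[y fy] Nmax.
have Nub y' : (f y' <= N)%N by apply: Nmax; apply/asboolP; exists y'.
exists N; split.
- apply/eqP; rewrite eq_le; apply/andP; split.
    apply: ge_sup; first by exists (f (p z0))%:R; exists (p z0).
    by move=> _ [y' _ <-]; rewrite ler_nat; exact: Nub.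
  apply: ub_le_sup; last by exists y => //; rewrite -fy.
  by exists N%:R => _ [y' _ <-]; rewrite ler_nat; exact: Nub.
- apply: (@has_cover_gt0 A z0); apply/covnum_join_cover; exact: Nub.
- by move=> y'; apply/covnum_join_cover; exact: Nub.
- by exists y => n /covnum_join_cover; rewrite -/(f y) fy.
Qed.

Lemma cvg_rel_htop (F : nat -> {fset G}) : folner R F ->
  cvgn (fun n => #|` F n|%:R^-1 * ln (rel_covnum R p (@join_cover G Z aZ _ U (F n)))).
Proof.
apply: (@ornstein_weiss R G (fun A => ln (rel_covnum R p (@join_cover G Z aZ _ U A)))).
- have [N [-> N0 _ [y /(_ 1%N) N1]]] := rel_covnumP fset0.
  suff -> : N = 1%N by rewrite ln1.
  apply/eqP; rewrite eqn_leq N0 andbT; apply: N1.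
  by exists unit, (fun _ _ => ord0); rewrite card_unit; split => // z _; exists tt.
- move=> A B AB; have [M [-> M0 cM [y My]]] := rel_covnumP A.
  have [N [-> N0 cN _]] := rel_covnumP B.
  by rewrite ler_ln ?posrE ?ltr0n// ler_nat; apply/My/(has_coverS AB _ (cN y)).
- move=> A B; have [M [-> M0 cM _]] := rel_covnumP A.
  have [N [-> N0 cN _]] := rel_covnumP B.
  have [K [-> K0 _ [y Ky]]] := rel_covnumP (A `|` B)%fset.
  rewrite -lnM ?posrE ?ltr0n// ler_ln ?posrE ?mulr_gt0 ?ltr0n// -natrM ler_nat.
  exact/Ky/has_coverM.
- move=> A g; congr ln; have [M [-> M0 cM [y My]]] := rel_covnumP A.
  have [N [-> N0 cN [y' Ny']]] := rel_covnumP (fset_rmul A g).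
  congr _%:R; apply/eqP; rewrite eqn_leq; apply/andP; split.
    by apply/Ny'/has_cover_rmul.
  apply/My; have -> : A = fset_rmul (fset_rmul A g) g^-1.
    by apply/fsetP => x; rewrite !in_fset_rmul invgK mulgK.
  exact/has_cover_rmul.
Qed.

Lemma rel_htop_gt0 (F : nat -> {fset G}) (c : R) : folner R F -> 0 < c ->
  (\forall n \near \oo, exists y, forall N : nat, has_cover (F n) (fiber y) N ->
     expR (c * #|` F n|%:R) <= N%:R) ->
  0 < rel_htop R aZ p F U.
Proof.
move=> fF c0 h; apply: (lt_le_trans c0); apply: limr_ge; first exact: cvg_rel_htop.
apply: filterS h => n [y yP]; have [N [-> N0 cN _]] := rel_covnumP (F n).
rewrite mulrC ler_pdivlMr ?card_folner_gt0//.
by rewrite -ler_expR lnK ?posrE ?ltr0n//; exact/yP.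
Qed.

Lemma rel_htop_gt0_cover (F : nat -> {fset G}) : folner R F ->
  0 < rel_htop R aZ p F U -> exists2 c : R, 0 < c &
  \forall n \near \oo, exists y, forall N : nat, has_cover (F n) (fiber y) N ->
     expR (c * #|` F n|%:R) <= N%:R.
Proof.
move=> fF h; exists (rel_htop R aZ p F U / 2); first by rewrite divr_gt0.
have h2 : rel_htop R aZ p F U / 2 < rel_htop R aZ p F U by lra.
have /cvgr_gt/(_ _ h2) := cvg_rel_htop fF.
apply: filterS => n; have [N [-> N0 _ [y yP]]] := rel_covnumP (F n).
rewrite [ltRHS]mulrC ltr_pdivlMr ?card_folner_gt0// => /ltW le; exists y => m /yP Nm.
apply: (@le_trans _ _ N%:R); last by rewrite ler_nat.
by rewrite -[leRHS]lnK ?posrE ?ltr0n// ler_expR.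
Qed.

End RelativeEntropy.

(** * Independent sets and positive entropy *)

Section Independence.
Variables (R : realType) (G : groupType) (Z W : topologicalType).
Variables (aZ : gaction G Z) (aW : gaction G W) (p : Z -> W).
Hypothesis p_equiv : forall g z, p (aZ g z) = aW g (p z).

Definition independent (A : 'I_2 -> set Z) (J : {fset G}) : Prop :=
  exists y, forall s : G -> 'I_2, exists2 z, p z = y &
    forall g, g \in J -> A (s g) (aZ g z).

Lemma independent_hereditary A : hereditary (independent A).
Proof.
move=> J J' /fsubsetP JJ' [y yP]; exists y => s; have [z zy zP] := yP s.
by exists z => // g /JJ'; exact: zP.
Qed.

Lemma independent_translation A : translation_invariant (independent A).
Proof.
move=> J g [y yP]; exists (aW g^-1%g y) => s.
have [z zy zP] := yP (fun h => s (h * g)%g); exists (aZ g^-1%g z).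
  by rewrite p_equiv zy.
move=> h; rewrite in_fset_rmul => /zP; rewrite mulgVK -gactM; exact.
Qed.

Lemma independentS A B J : (forall i, A i `<=` B i) -> independent A J -> independent B J.
Proof.
move=> AB [y yP]; exists y => s; have [z zy zP] := yP s.
by exists z => // g /zP; exact: AB.
Qed.

(** Let [z] have the value [i] at [g] when [g z] is outside [U i]. Two values exclude each other
    because [U] covers, and a list of patterns avoiding every point of a fibre is a subcover of that
    fibre; so exponential covering numbers give a large shattered set. *)
Lemma rel_htop_independent (U : 'I_2 -> set Z) (F : nat -> {fset G}) (z0 : Z) :
  \bigcup_i U i = [set: Z] -> folner R F -> 0 < rel_htop R aZ p F U ->
  dense_along R F (independent (fun i => ~` U i)).
Proof.
move=> Ucov fF /(rel_htop_gt0_cover z0 p_equiv Ucov fF)[c c0 h].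
have [d d0 dP] := exists_large_shattered c0.
exists d => //; apply: filterS h => n [y yP].
pose K i (g : F n) z := ~ U i (aZ (\val g) z).
have [||L LP|J sJ dJ] := dP Z (F n) K (p @^-1` [set y]).
- by rewrite -cardfE cardfs_gt0; case: fF.
- move=> i j g z Ki Kj; apply/eqP; apply: contrapT => /negP ij.
  have : [set: Z] (aZ (\val g) z) by [].
  rewrite -Ucov => -[k _]; have [->|->] := ord2_neq k ij; [exact: Ki|exact: Kj].
- rewrite -cardfE; apply: yP.
  pose ext (s : {ffun F n -> 'I_2}) g := if insub g is Some g' then s g' else ord0.
  exists 'I_(size L), (fun j => ext (tnth (in_tuple L) j)); rewrite card_ord; split => //.
  move=> z /LP[t /seq_tnthP[j ->] jP]; exists j => g gF; rewrite /ext insubT.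
  by apply: contrapT; exact: (jP [` gF]%fset).
- rewrite -cardfE in dJ.
  exists [fset \val g | g in J]%fset; split.
  + by apply/fsubsetP => _ /imfsetP[g _ ->]; exact: valP.
  + exists y => s; have [z zy zP] := sJ [ffun g => s (\val g)].
    exists z => // _ /imfsetP[g /= gJ ->].
    by have := zP g gJ; rewrite /K ffunE.
  + by rewrite card_imfset ?size_enum_finmem//= -?cardE//; exact: val_inj.
Qed.

End Independence.

(** * Positive entropy from finitely many independent pairs *)

Section IndependenceOfCombinations.
Variables (R : realType) (G : groupType) (X Y Z W : topologicalType).
Variables (aX : gaction G X) (aZ : gaction G Z) (aY : gaction G Y) (aW : gaction G W).
Variables (pi : X -> Y) (p : Z -> W).
Hypothesis pi_equiv : forall g x, pi (aX g x) = aY g (pi x).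
Hypothesis p_equiv : forall g z, p (aZ g z) = aW g (p z).
Variables (I : finType) (avg : (I -> X) -> Z).
Hypothesis avg_equiv : forall g x, aZ g (avg x) = avg (fun i => aX g (x i)).
Hypothesis avg_fiber : forall x x', (forall i, pi (x i) = pi (x' i)) ->
  p (avg x) = p (avg x').

(** A common independent set [J] gives for every pattern [s] a tuple of points following [s]. The
    tuples for different [s] agree fibrewise, so their images under [avg] lie in one fibre of [p],
    which then needs [2 ^ #|J|] cover elements. *)
Lemma rel_htop_avg_gt0 (U : 'I_2 -> set Z) (A : I -> 'I_2 -> set X)
    (F : nat -> {fset G}) :
  \bigcup_i U i = [set: Z] -> folner R F ->
  (forall b x, (forall i, A i b (x i)) -> ~ U b (avg x)) ->
  (forall i, dense_along R F (independent aX pi (A i))) -> (I -> X) ->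
  0 < rel_htop R aZ p F U.
Proof.
move=> Ucov fF AU dA x0.
have [d d0 dP] := dense_along_forall fF
  (fun i => @independent_hereditary G X Y aX pi (A i))
  (fun i => @independent_translation G X Y aX aY pi pi_equiv (A i)) dA.
have ln2 : 0 < ln 2 :> R by rewrite ln_gt0// ltr1n.
apply: (rel_htop_gt0 (avg x0) p_equiv Ucov fF (mulr_gt0 ln2 d0)).
apply: filterS dP => n [J [JF /(_ _)/cid-/all_sig[y yP] dJ]].
have /choice[x xP] : forall s : G -> 'I_2, exists x : I -> X,
    forall i, pi (x i) = y i /\ forall g, g \in J -> A i (s g) (aX g (x i)).
  move=> s; have /choice[x xP] : forall i, exists xi, pi xi = y i /\
      forall g, g \in J -> A i (s g) (aX g xi).
    by move=> i; have [xi ? ?] := yP i s; exists xi.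
  by exists x.
exists (p (avg (x (fun=> ord0)))) => N [T [t [TN tP]]].
(* The cover element containing the point for [s] must differ from [s] everywhere on [J]. With two
   symbols it determines [s], whence the injectivity of [f]. *)
have /choice[f fP] : forall s : {ffun J -> 'I_2}, exists j : T, forall g : J,
    t j (\val g) != s g.
  move=> s; pose s' g := if insub g is Some g' then s g' else ord0.
  have [|j jP] := tP (avg (x s')).
    by apply: avg_fiber => i; rewrite !(xP _ i).1.
  exists j => g; apply/eqP => tj.
  apply: (AU (s g) (fun i => aX (\val g) (x s' i))) => [i|].
    have -> : s g = s' (\val g) by rewrite /s' valK.
    exact: (xP _ i).2 _ (valP g).
  rewrite -avg_equiv -tj; apply: jP; move/fsubsetP : JF; apply; exact: valP.
have finj : injective f.
  move=> s s' e; apply/ffunP => g; have := fP s g; have := fP s' g; rewrite -e => h' h.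
  have [<-|ss] := eqVneq (s g) (s' g) => //.
  by case: (ord2_neq (t (f s) (\val g)) ss) => e'; rewrite e' eqxx in h h'.
apply: (@le_trans _ _ (2 ^ #|` J|)%:R); last first.
  rewrite ler_nat; apply: leq_trans TN.
  rewrite cardfE -[X in (X ^ _)%N]card_ord -card_ffun.
  by rewrite -(card_codom finj) max_card.
rewrite natrX -[X in _ <= X ^+ _](@lnK R 2) ?posrE// -expRM_natl ler_expR.
by rewrite -mulrA mulrC ler_pM2r.
Qed.

End IndependenceOfCombinations.

(** The number of sets containing a point is a bounded integer, so its maximum is attained and is at
    least its mean. *)
Lemma exists_ge_mean (R : realType) (d : measure_display) (T : measurableType d)
    (P : probability T R) (I : Type) (r : seq I) (B : I -> set T) (a : R) :
  (forall i, measurable (B i)) -> (a%:E <= \sum_(i <- r) P (B i))%E ->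
  exists x, a <= (\sum_(i <- r) `[< B i x >])%N%:R.
Proof.
move=> mB aP; pose S x := (\sum_(i <- r) `[< B i x >])%N.
have SE x : (S x)%:R%:E = (\sum_(i <- r) (\1_(B i) x : R)%:E)%E.
  rewrite sumEFin /S natr_sum; congr (_%:E); exact: eq_bigr.
have exS : exists n, `[< exists x, S x = n >].
  by exists (S point); apply/asboolP; exists point.
have Sr n : `[< exists x, S x = n >] -> (n <= size r)%N.
  move=> /asboolP[x <-]; rewrite /S -sum1_size; apply: leq_sum => i _.
  exact: leq_b1.
case: (ex_maxnP exS Sr) => N /asboolP[x Sx] Nmax.
exists x; rewrite -/(S x) Sx -lee_fin (le_trans aP)//.
have -> : (\sum_(i <- r) P (B i) = \int[P]_x (S x)%:R%:E)%E.
  under [RHS]eq_integral do rewrite SE.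
  rewrite ge0_integral_sum//.
    by apply: eq_bigr => i _; rewrite integral_indic// setIT.
  by move=> i; apply/measurable_EFinP; exact: measurable_indic.
apply: (@le_trans _ _ (\int[P]_x (N%:R : R)%:E)%E).
  apply: ge0_le_integral => //.
  - rewrite (_ : (fun x => _) = fun x => (\sum_(i <- r) (\1_(B i) x : R)%:E)%E); last first.
      exact/funext.
    apply: emeasurable_sum => i; apply/measurable_EFinP; exact: measurable_indic.
  - by move=> y _; rewrite lee_fin ler_nat; apply: Nmax; apply/asboolP; exists y.
by rewrite integral_cst//= probability_setT mule1.
Qed.

(** * Independence for pairs of points in one fibre *)

Section PairIndependence.
Variables (R : realType) (G : groupType) (X Y : pmetricType R).
Hypothesis compX : compact [set: X].
Variables (aX : gaction G X) (aY : gaction G Y) (pi : factor_map aX aY).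
Hypothesis upe : rel_upe R aX pi.

Let pi_equiv g x : pi (aX g x) = aY g (pi x). Proof. exact: fmap_equivariant. Qed.

Lemma image_closed (C : set X) : closed C -> closed (pi @` C).
Proof.
move=> cC; apply: compact_closed; first exact: metric_hausdorff.
apply: continuous_compact.
  by apply: continuous_subspaceT; exact: fmap_continuous.
exact: (subclosed_compact cC compX).
Qed.

(** The complements of two disjoint closed neighbourhoods form an open cover that is non-dense on
    the common fibre, and independence for the complements of this cover is independence for the
    neighbourhoods. *)
Lemma distinct_pair_dense (x : 'I_2 -> X) (A : 'I_2 -> set X) (F : nat -> {fset G}) :
  folner R F -> x ord0 <> x ord_max -> pi (x ord0) = pi (x ord_max) ->
  (forall i, nbhs (x i) (A i)) -> dense_along R F (independent aX pi A).
Proof.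
move=> fF x01 pix nA.
have [[V0 V1] /= [xO0 xO1] [oO0 oO1 O01]] :
    exists2 AB : set X * set X, x ord0 \in AB.1 /\ x ord_max \in AB.2 &
      [/\ open AB.1, open AB.2 & AB.1 `&` AB.2 == set0].
  by have := @metric_hausdorff _ X; rewrite open_hausdorff; apply; exact/eqP.
pose O (i : 'I_2) := if i == ord0 then V0 else V1.
have ix (i : 'I_2) : i = ord0 \/ i = ord_max by exact: ord2_neq.
have nO i : nbhs (x i) (O i).
  by case: (ix i) => ->; apply: open_nbhs_nbhs; split => //; apply: set_mem.
have Odisj z : O ord0 z -> O ord_max z -> False.
  by move=> z0 z1; move/eqP : O01; apply/eqP/set0P; exists z.
have /choice[N NP] : forall i, exists N, nbhs (x i) N /\ closure N `<=` A i `&` O i.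
  move=> i; have [N nN cN] := @uniform_regular X (x i) _ (filterI (nA i) (nO i)).
  by exists N.
pose U i := ~` closure (N i).
have oU i : open (U i) by apply: closed_openC; exact: closed_closure.
have Ucov : \bigcup_i U i = [set: X].
  apply/seteqP; split => // z _.
  have [z0|z0] := pselect (closure (N ord0) z); last by exists ord0.
  exists ord_max => // z1; apply: (Odisj z).
    exact: ((NP ord0).2 z z0).2.
  exact: ((NP ord_max).2 z z1).2.
have ndU : nondense_on_fiber pi U.
  exists (pi (x ord0)) => i /(_ (x i)) h.
  have : closure (U i) (x i) by apply: h; case: (ix i) => -> /=.
  move=> /(_ _ (NP i).1)[z [Uz Nz]]; apply: Uz; exact: subset_closure.
have := rel_htop_independent pi_equiv (x ord0) Ucov fF (upe oU Ucov ndU fF).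
move=> [c c0 h]; exists c => //; apply: filterS h => n [J [JF iJ cJ]].
exists J; split => //; apply: independentS iJ => i z /contrapT cz.
exact: ((NP i).2 z cz).1.
Qed.

Hypothesis suppY : supp_system R aY = [set: Y].

(** An invariant measure with [y] in its support charges [W], and the mean number of visits to [W]
    along [F n] is [mu W] times the size of [F n]. *)
Lemma visits_dense (W : set Y) (y : Y) (F : nat -> {fset G}) :
  folner R F -> open W -> W y ->
  dense_along R F (fun J => exists y, forall g, g \in J -> W (aY g y)).
Proof.
move=> fF oW Wy.
have : supp_system R aY y by rewrite suppY.
move=> [mu /= muG suppy].
have mW : measurable (W : set (g_sigma_algebraType (@open Y))).
  exact: sub_sigma_algebra.
have muW : (0 < mu W)%E.
  rewrite lt0e measure_ge0 andbT; apply/eqP => W0.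
  suff : (~` W) y by [].
  apply: suppy; split; first exact: open_closedC.
  by rewrite probability_setC// W0 sube0.
have fW : (mu W \is a fin_num)%E by exact: fin_num_measure.
exists (fine (mu W)); first by rewrite fine_gt0// muW ltey_eq fW.
near=> n.
pose B g : set (g_sigma_algebraType (@open Y)) := aY g @^-1` W.
have mB g : measurable (B g).
  apply: sub_sigma_algebra; apply: open_comp => // ? _; exact: gact_continuous.
have [|y' y'P] := @exists_ge_mean R _ _ mu _ (F n) B (fine (mu W) * #|` F n|%:R) mB.
  rewrite (eq_bigr (fun=> mu W)); last first.
    move=> g _; rewrite -[in RHS](muG g) /bprob_act bpushE//.
  rewrite -(fineK fW) sumEFin lee_fin big_const_seq count_predT iter_addr_0.
  by rewrite mulr_natr.
exists [fset g in F n | `[< B g y' >]]%fset; split.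
- by apply/fsubsetP => g; rewrite !inE => /andP[].
- by exists y' => g; rewrite !inE => /andP[_ /asboolP].
- by rewrite card_fset_sep.
Unshelve. all: end_near. Qed.

Lemma pair_dense (x : 'I_2 -> X) (A : 'I_2 -> set X) (F : nat -> {fset G}) :
  folner R F -> pi (x ord0) = pi (x ord_max) ->
  (forall i, nbhs (x i) (A i)) -> dense_along R F (independent aX pi A).
Proof.
move=> fF pix nA.
have [x01|/(distinct_pair_dense fF)] := pselect (x ord0 = x ord_max); last exact.
have ix (i : 'I_2) : i = ord0 \/ i = ord_max by exact: ord2_neq.
have [z xz] : {z | x = fun=> z}.
  exists (x ord0); apply/funext => i; case: (ix i) => -> //.
rewrite {}xz {x pix x01} in nA.
pose A01 := A ord0 `&` A ord_max.
have A01A i : A01 `<=` A i by case: (ix i) => -> w [].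
have nA01 : nbhs z A01 by exact: filterI.
(* For another point [z'] of the fibre, the pair [(z, z')] yields dense sets along which some point
   of a fibre stays in [A01]. This constant pattern serves for every [s], because [A01] lies in both
   sets. *)
have [[z' [zz' piz]]|single] := pselect (exists z', z <> z' /\ pi z = pi z').
  pose x (i : 'I_2) := if i == ord0 then z else z'.
  pose A' (i : 'I_2) := if i == ord0 then A01 else setT.
  have nA' i : nbhs (x i) (A' i).
    by rewrite /x /A'; case: ifP => // _; exact: filterT.
  have [c c0 h] := @distinct_pair_dense x A' F fF zz' piz nA'.
  exists c => //; apply: filterS h => n [J [JF [y yP] cJ]].
  exists J; split => //; exists y => s; have [w wy wP] := yP (fun=> ord0).
  by exists w => // g gJ; apply: A01A; exact: wP.
(* [W] is the set of points whose whole fibre lies in [O]; it is open because [pi] is a closed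
   map. *)
pose O := interior A01; pose W := ~` (pi @` (~` O)).
have oW : open W.
  apply: closed_openC; apply: image_closed; apply: open_closedC.
  exact: open_interior.
have Wz : W (pi z).
  move=> [w Ow piw]; have [zw|zw] := pselect (z = w).
    by apply: Ow; rewrite -zw.
  by apply: single; exists w.
have [c c0 h] := visits_dense fF oW Wz.
exists c => //; apply: filterS h => n [J [JF [y yP] cJ]].
exists J; split => //; exists y => s; have [w wy] := fmap_surj pi y.
exists w => // g gJ; apply: A01A; apply: interior_subset; apply: contrapT => nO.
by apply: (yP g gJ); exists (aX g w) => //; rewrite pi_equiv wy.
Qed.

End PairIndependence.

Local Notation borel X := (g_sigma_algebraType (@open X)).

(** * Finitely supported measures *)

Section AtomicMeasures.
Variables (R : realType) (X : ptopologicalType) (I : finType).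
Local Open Scope ereal_scope.
Variables (w : I -> R) (x : I -> X).
Hypothesis w0 : forall i, (0 <= w i)%R.

(** [msum] adds measures indexed by [nat], so the atoms are enumerated and the sequence is continued
    by the zero measure. *)
Definition atom_family (k : nat) : {measure set (borel X) -> \bar R} :=
  if insub k is Some j then
    mscale (NngNum (w0 (@enum_val _ I j))) (dirac (x (enum_val j) : borel X))
  else mzero.

Definition atomic_measure : {measure set (borel X) -> \bar R} := msum atom_family #|I|.

Lemma atom_familyE (j : 'I_#|I|) : atom_family j =
  mscale (NngNum (w0 (@enum_val _ I j))) (dirac (x (enum_val j) : borel X)).
Proof. by rewrite /atom_family valK. Qed.

Lemma atomic_measureE A : atomic_measure A = \sum_(i : I) (w i)%:E * \d_(x i : borel X) A.
Proof.
transitivity (\sum_(j < #|I|) atom_family j A); first by [].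
under eq_bigr do rewrite atom_familyE.
by rewrite [RHS](big_enum_val (A := [pred _ : I | true])).
Qed.

Lemma ge0_integral_atomic (f : borel X -> \bar R) : (forall x, 0 <= f x) ->
  measurable_fun setT f -> \int[atomic_measure]_y f y = \sum_(i : I) (w i)%:E * f (x i).
Proof.
move=> f0 mf; rewrite /atomic_measure ge0_integral_measure_sum//.
under eq_bigr do rewrite atom_familyE ge0_integral_mscale//= integral_dirac// diracT mul1e.
by rewrite [RHS](big_enum_val (A := [pred _ : I | true])).
Qed.

Hypothesis w1 : (\sum_i w i = 1)%R.

Lemma atomic_measureT : atomic_measure setT = 1.
Proof.
rewrite atomic_measureE; under eq_bigr do rewrite diracT mule1.
by rewrite sumEFin w1.
Qed.

Definition atomic_probability : probability (borel X) R :=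
  HB.pack (atomic_measure : set (borel X) -> \bar R) (Measure.on atomic_measure)
    (Measure_isProbability.Build _ _ _ atomic_measure atomic_measureT).

Definition atomic : bprob R X := bprob_of atomic_probability.

Lemma atomicE A : measurable A -> atomic A = \sum_(i : I) (w i)%:E * \d_(x i : borel X) A.
Proof. by move=> mA; rewrite /= brestrE//= -atomic_measureE. Qed.

Lemma atomic_eval (f : continuousType X R) :
  bprob_eval atomic f = (\sum_i w i * f (x i))%R.
Proof.
rewrite /bprob_eval /Rintegral (eq_measure_integral atomic_measure); last first.
  by move=> A mA _; rewrite /= brestrE.
have mf : measurable_fun [set: borel X] (fun y : borel X => (f y)%:E).
  by apply/measurable_EFinP; apply: borel_measurableR; exact: cts_fun.
rewrite integralE !ge0_integral_atomic//; [|exact: measurable_funeneg|exact: measurable_funepos].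
under eq_bigr do rewrite funeposE -EFin_max -EFinM.
under [X in _ - X]eq_bigr do rewrite funenegE -EFinN -EFin_max -EFinM.
rewrite !sumEFin -EFinB/= -sumrB; apply: eq_bigr => i _; rewrite -mulrBr.
by congr (_ * _)%R; case: (leP 0 (f (x i)))%R => h; case: (leP 0 (- f (x i)))%R => h'; lra.
Qed.

End AtomicMeasures.

(** * Basic neighbourhoods in the weak-* topology *)

Section WeakTopology.
Variables (R : realType) (X : ptopologicalType).

(** The sets that contain a basic neighbourhood form a filter [F]. Every evaluation converges along
    [F] to its value at [mu], hence [F] converges to [mu] in the initial topology. *)
Lemma nbhs_bprob (mu : bprob R X) (V : set (bprob R X)) : nbhs mu V ->
  exists (I : finType) (f : I -> continuousType X R) (e : R), 0 < e /\
    forall nu, (forall i, `|bprob_eval nu (f i) - bprob_eval mu (f i)| < e) -> V nu.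
Proof.
pose F : set_system (bprob R X) := [set V | exists (I : finType)
  (f : I -> continuousType X R) (e : R), 0 < e /\
    forall nu, (forall i, `|bprob_eval nu (f i) - bprob_eval mu (f i)| < e) -> V nu].
have FF : Filter F.
  split.
  - by exists void, (fun i : void => match i with end), 1.
  - move=> P Q [I [f [e [e0 fP]]]] [J [g [d [d0 gQ]]]].
    exists (I + J)%type, (fun k => match k with inl i => f i | inr j => g j end).
    exists (Num.min e d); rewrite lt_min e0 d0; split => // nu h; split.
      by apply: fP => i; have := h (inl i); rewrite lt_min => /andP[].
    by apply: gQ => i; have := h (inr i); rewrite lt_min => /andP[].
  - move=> P Q PQ [I [f [e [e0 fP]]]]; exists I, f, e; split => // nu /fP.
    exact: PQ.
suff : F --> mu by apply.
move=> A [_ [[B Bop <-] Bmu BA]]; apply: filterS BA _.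
have /(_ B) : (@bprob_eval R X @ F) --> (bprob_eval mu : {ptws continuousType X R -> R}).
  apply/cvg_sup.
  move=> h C [_ [[D oD <-] Dmu DC]]; apply: filterS DC _.
  have /nbhs_ballP[e /= e0 eD] : nbhs (bprob_eval mu h : R) D by exact: open_nbhs_nbhs.
  exists unit, (fun=> h), e; split => // nu /(_ tt) nuh.
  by apply: eD; rewrite /ball/= distrC.
by apply; exact: open_nbhs_nbhs.
Qed.

End WeakTopology.

(** * Relatively independent coupling on a finite partition *)

Section Coupling.
Variables (R : realType) (d d' : measure_display).
Variables (T : measurableType d) (S : measurableType d').
Local Open Scope ereal_scope.
Variables (n : nat) (lab : T -> 'I_n).
Let A k := lab @^-1` [set k].
Hypothesis mA : forall k, measurable (A k).

Let trivA (r : seq 'I_n) : trivIset [set` r] A.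
Proof.
apply/trivIsetP => i j _ _ ij; apply/seteqP; split => // x [/= xi xj].
by move: ij; rewrite -xi -xj eqxx.
Qed.

Let covA : \big[setU/set0]_(k < n) A k = setT.
Proof.
by apply/seteqP; split => // x _; rewrite (bigD1 (lab x))//=; left.
Qed.

Lemma sum_integral_label (P : {measure set T -> \bar R}) (f : T -> \bar R) :
  (forall x, 0 <= f x) -> measurable_fun setT f ->
  \sum_(k < n) \int[P]_(x in A k) f x = \int[P]_x f x.
Proof.
move=> f0 mf; rewrite -covA ge0_integral_bigsetU//.
- by rewrite index_enum_uniq.
- by rewrite covA.
Qed.

Lemma sum_measure_label (P : {measure set T -> \bar R}) (B : set T) :
  measurable B -> \sum_(k < n) P (B `&` A k) = P B.
Proof.
move=> mB; rewrite -[in RHS](setIT B) -integral_indic// -sum_integral_label//.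
  by apply: eq_bigr => k _; rewrite integral_indic.
by apply/measurable_EFinP; exact: measurable_indic.
Qed.

(* The relatively independent coupling of [P1] and [P2] over their common image,
   restricted to the cells of a finite partition. *)
Lemma exists_coupling (P1 P2 : probability T R) (phi : {mfun T >-> S})
    (D : 'I_n -> set S) :
  (forall l, measurable (D l)) -> (forall l, A l `<=` phi @^-1` D l) ->
  (forall E, measurable E -> P1 (phi @^-1` E) = P2 (phi @^-1` E)) ->
  exists w : 'I_n -> 'I_n -> R, [/\ forall k l, (0 <= w k l)%R,
    forall k, (\sum_l w k l)%R = fine (P1 (A k)),
    forall l, (\sum_k w k l)%R = fine (P2 (A l)) &
    forall k l, A k `&` phi @^-1` D l = set0 -> w k l = 0%R].
Proof.
move=> mD AD P12; pose Q : probability S R := distribution P1 phi.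
have mphi E : measurable E -> measurable (phi @^-1` E).
  by move=> mE; rewrite -[X in measurable X]setTI; exact: measurable_funP.
have QE E : measurable E -> Q E = P2 (phi @^-1` E) by move=> mE; rewrite -P12.
(* [q l] is the conditional probability of the cell [A l] under [P2] given [phi], obtained as a
   Radon-Nikodym derivative with respect to the common image [Q]. *)
have /choice[q qP] : forall l, exists q : S -> \bar R, [/\ forall y, 0 <= q y,
    Q.-integrable setT q &
    forall E, measurable E -> P2 (phi @^-1` E `&` A l) = \int[Q]_(y in E) q y].
  move=> l; have Pl : P2 (A l) < +oo by rewrite ltey_eq fin_num_measure.
  pose rl0 : {measure set S -> \bar R} := pushforward (mfrestr (mA l) Pl) phi.
  pose rl : {measure set S -> \bar R} := rl0 (measurable_funP phi).
  have frl : fin_num_fun rl.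
    by move=> E mE; apply: fin_num_measure; exact: mphi.
  pose rho : {finite_measure set S -> \bar R} :=
    HB.pack (rl : set S -> \bar R) (Measure.on rl) (Measure_isFinite.Build _ _ _ rl frl).
  have rhoQ : rho `<< Q.
    apply/null_content_dominatesP => E mE Q0.
    have {}Q0 : P2 (phi @^-1` E) = 0 by rewrite -QE.
    apply/eqP; rewrite eq_le measure_ge0 andbT -[leRHS]Q0 /=.
    by apply: le_measure; rewrite ?inE; [apply: measurableI => //; exact: mphi
      |exact: mphi|exact: subIsetl].
  have [q [q0 iq qE]] := radon_nikodym_finite rhoQ.
  by exists q; split => // E mE; rewrite -qE.
(* Cutting [q l] off outside [D l] preserves its integrals, as [A l] lies over [D l], and makes the
   weights vanish exactly where the last conclusion requires it. *)
pose u l := q l \_ (D l).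
have u0 l y : 0 <= u l y.
  by rewrite /u /patch; case: ifP => // _; have [] := qP l.
have mu l : measurable_fun setT (u l).
  apply: (measurable_restrictT _ (mD l)).1; apply: measurable_funTS.
  by have [_ /measurable_int ? _] := qP l.
have uE l E : measurable E -> \int[Q]_(y in E) u l y = P2 (phi @^-1` E `&` A l).
  move=> mE; rewrite /u -integral_mkcondr; have [_ _ <-] := qP l; last exact: measurableI.
  congr (P2 _); apply/seteqP; split => x [] //=; first by case.
  by move=> Ex Ax; split => //; split => //; exact: AD.
have muphi l : measurable_fun setT (u l \o phi) by exact: measurableT_comp.
pose W k l := \int[P1]_(x in A k) u l (phi x).
have W0 k l : 0 <= W k l by apply: integral_ge0.
have Wl l : \sum_(k < n) W k l = P2 (A l).
  rewrite sum_integral_label//; last exact: muphi.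
  transitivity (\int[Q]_y u l y).
    by rewrite ge0_integral_distribution.
  by rewrite uE// preimage_setT setTI.
have Wfin k l : W k l \is a fin_num.
  rewrite ge0_fin_numE// (@le_lt_trans _ _ (P2 (A l)))//; last first.
    by rewrite ltey_eq fin_num_measure.
  by rewrite -Wl (bigD1 k)//= leeDl// sume_ge0.
have Wk k : \sum_(l < n) W k l = P1 (A k).
  (* The cells partition the space, so their conditional probabilities add up to 1 almost
     everywhere. *)
  have ae1 : ae_eq Q setT (cst 1) (fun y => \sum_(l < n) u l y).
    apply: integral_ae_eq => //.
    - exact: finite_measure_integrable_cst.
    - exact: emeasurable_sum.
    move=> E _ mE; rewrite ge0_integral_sum//; last by move=> l; exact: measurable_funTS.
    under eq_bigr do rewrite uE//.
    rewrite sum_measure_label; last exact: mphi.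
    by rewrite integral_cst// mul1e; exact: QE.
  rewrite -ge0_integral_sum//; last first.
    by move=> l; apply: measurable_funTS; exact: muphi.
  transitivity (\int[P1]_(x in A k) cst 1 x); last by rewrite integral_cst// mul1e.
  apply: ae_eq_integral => //.
    by apply: measurable_funTS; apply: emeasurable_sum => l; exact: muphi.
  have [N [mN QN sN]] := ae1; exists (phi @^-1` N); split => //; first exact: mphi.
  move=> x /= h; apply: sN => /= h'; apply: h => _.
  by rewrite -h'.
exists (fun k l => fine (W k l)); split.
- by move=> k l; exact: fine_ge0.
- by move=> k; rewrite sum_fine// Wk.
- by move=> l; rewrite sum_fine// Wl.
- move=> k l kl; rewrite /W integral0_eq// => x Ax; rewrite /u /patch; case: ifP => //.
  by move=> /set_mem Dx; have : set0 x by rewrite -kl.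
Qed.

End Coupling.

Lemma label_estimate (R : realType) (d : measure_display) (T : measurableType d)
    (P : probability T R) (n : nat) (lab : T -> 'I_n) (f : T -> R) (c : 'I_n -> R) (e : R) :
  (forall k, measurable (lab @^-1` [set k])) -> P.-integrable setT (EFin \o f) ->
  (forall x, `|f x - c (lab x)| <= e) ->
  `|\int[P]_x f x - \sum_k fine (P (lab @^-1` [set k])) * c k| <= e.
Proof.
move=> mA fint fc; pose A k := lab @^-1` [set k].
pose h k x := ((c k)%:E * (\1_(A k) x)%:E)%E.
have hint k : P.-integrable setT (h k).
  by apply: integrableZl => //; apply: integrable_indic; exact: mA.
have sE : EFin \o (c \o lab) = (fun x => \sum_(k < n) h k x)%E.
  apply/funext => x; rewrite (bigD1 (lab x))//= big1; last first.
    move=> k klab; rewrite /h indicE memNset; first by rewrite mule0.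
    by move=> kx; move: klab; rewrite -kx eqxx.
  by rewrite /h indicE mem_set//= mule1 adde0.
have sint : P.-integrable setT (EFin \o (c \o lab)).
  by rewrite sE; exact: integrable_sum.
have -> : \sum_k fine (P (lab @^-1` [set k])) * c k = \int[P]_x (c \o lab) x.
  rewrite /Rintegral -[X in integral _ _ X]/(EFin \o (c \o lab)) sE integral_sum//.
  rewrite -sum_fine; last first.
    by move=> k _; apply: integrable_fin_num.
  apply: eq_bigr => k _; rewrite integralZl//; last by apply: integrable_indic; exact: mA.
  rewrite integral_indic//; last exact: mA.
  rewrite setIT fineM//; first by rewrite mulrC.
  exact/fin_num_measure/mA.
have dint : P.-integrable setT (EFin \o (fun x => f x - (c \o lab) x)).
  by have := integrableB measurableT fint sint; apply: eq_integrable.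
rewrite -RintegralB//; apply: le_trans (le_normr_Rintegral _ _) _ => //.
apply: (@le_trans _ _ (\int[P]_(x in setT) e)); last first.
  have P1 : fine (P setT) = 1 by have -> := probability_setT P.
  by rewrite Rintegral_cst// P1 mulr1.
apply: le_Rintegral => //.
- by have := integrable_norm dint.
- exact: finite_measure_integrable_cst.
Qed.

Lemma weighted_sum_estimate (R : realType) (K : finType) (w a b : K -> R) (e : R) :
  (forall k, 0 <= w k) -> \sum_k w k = 1 ->
  (forall k, w k != 0 -> `|a k - b k| <= e) ->
  `|\sum_k w k * a k - \sum_k w k * b k| <= e.
Proof.
move=> w0 w1 ab; rewrite -sumrB (le_trans (ler_norm_sum _ _ _))//.
rewrite -[leRHS]mul1r -w1 mulr_suml; apply: ler_sum => k _.
rewrite -mulrBr normrM ger0_norm//; have [->|wk] := eqVneq (w k) 0.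
  by rewrite !mul0r.
by rewrite ler_wpM2l// ab.
Qed.

Lemma bprob_integrable (R : realType) (X : ptopologicalType) (mu : bprob R X)
    (f : continuousType X R) : compact [set: X] ->
  mu.-integrable setT (EFin \o (f : borel X -> R)).
Proof.
move=> cX; apply: measurable_bounded_integrable => //.
- by rewrite ltey_eq fin_num_measure.
- by apply: borel_measurableR; exact: cts_fun.
have : compact (f @` setT).
  by apply: continuous_compact => //; apply: continuous_subspaceT; exact: cts_fun.
move=> /(@compact_bounded R R^o)[M [Mr MP]]; exists M; split => // N MN x _.
by apply: (MP N MN); exists x.
Qed.

(** * Approximation of two measures with the same image by paired atoms *)

Section ApproximationOfPairs.
Variables (R : realType) (X Y : ptopologicalType) (pi : X -> Y) (cpi : continuous pi).
Hypothesis compX : compact [set: X].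
Hypothesis closed_pi : forall C, closed C -> closed (pi @` C).

(** The label of a point is the first member of a finite subcover that contains it. The estimate is
    stated on closures because the paired atoms may lie on the boundary of a cell. *)
Lemma exists_label (I : finType) (f : I -> continuousType X R) (e : R) : 0 < e ->
  exists (n : nat) (lab : X -> 'I_n) (c : 'I_n -> X),
    (forall k, measurable (lab @^-1` [set k] : set (borel X))) /\
    forall k x i, closure (lab @^-1` [set k]) x -> `|f i x - f i (c k)| <= e.
Proof.
move=> e0; pose V (c : X) := [set z | forall i, `|f i z - f i c| < e].
have oV c : open (V c).
  rewrite openE => z Vz; apply: filter_forall => i.
  apply: open_nbhs_nbhs; split; last exact: Vz.
  apply: (@open_comp _ _ (fun z => `|f i z - f i c|) [set t | t < e]); last exact: open_lt.
  move=> t _; apply: cvg_norm; apply: cvgB; last exact: cvg_cst.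
  exact: cts_fun.
have := compX; rewrite compact_cover => /(_ X setT V)[//| |s _ sV].
  by move=> x _; exists x => // i; rewrite subrr normr0.
have hs x : (find (fun c => `[< V c x >]) s < size s)%N.
  rewrite -has_find; have [c /= cs Vx] := sV x Logic.I.
  by apply/hasP; exists c => //; apply/asboolP.
pose lab x := Ordinal (hs x).
exists (size s), lab, (fun k => nth point s k); split.
  move=> k; have -> : lab @^-1` [set k] =
      V (nth point s k) `\` \bigcup_(j in [set j | (j < k)%N]) V (nth point s j).
    apply/seteqP; split => x /=.
      move=> <- /=; split.
        apply/asboolP; have := hs x; rewrite -has_find => h.
        exact: (nth_find point h).
      by move=> [j /= jk /asboolP Vj]; have := before_find point jk; rewrite Vj.
    move=> [Vk nV]; apply: val_inj => /=; apply/eqP; rewrite eqn_leq; apply/andP; split.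
      rewrite leqNgt; apply/negP => /(before_find point)/negbT/negP; apply.
      exact/asboolP.
    rewrite leqNgt; apply/negP => jk; apply: nV; exists (lab x) => //.
    apply/asboolP; have := hs x; rewrite -has_find => h.
    exact: (nth_find point h).
  apply: measurableD; first exact: sub_sigma_algebra.
  by apply: bigcup_measurable => j _; exact: sub_sigma_algebra.
move=> k x i clx; set c := nth _ _ _.
suff : closed [set z | `|f i z - f i c| <= e].
  move/closure_id => E; have : closure [set z | `|f i z - f i c| <= e] x; last by rewrite -E.
  apply: closure_subset clx => z /= zk; rewrite /c -zk.
  apply: ltW; have := hs z; rewrite -has_find => h.
  have /asboolP := nth_find point h; exact.
apply: (@preimage_closed _ _ (fun z => `|f i z - f i c|) [set t | t <= e]); last exact: closed_le.
move=> z _; apply: cvg_norm; apply: cvgB; last exact: cvg_cst.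
exact: cts_fun.
Qed.

Lemma approx_pair (mu : 'I_2 -> bprob R X) (I : finType)
    (f : I -> continuousType X R) (e : R) :
  bpush cpi (mu ord0) = bpush cpi (mu ord_max) -> 0 < e ->
  exists (K : finType) (w : K -> R) (x : 'I_2 -> K -> X), [/\ forall k, 0 <= w k,
    \sum_k w k = 1, forall k, pi (x ord0 k) = pi (x ord_max k) &
    forall b i, `|\sum_k w k * f i (x b k) - bprob_eval (mu b) (f i)| <= e].
Proof.
move=> mu01 e0; have e20 : 0 < e / 2 by rewrite divr_gt0.
have [n [lab [c [mA labc]]]] := exists_label f e20.
pose A k := lab @^-1` [set k].
(* The image of a Borel cell need not be Borel, but the image of its closure is closed. *)
pose D l := pi @` closure (A l).
have mD l : measurable (D l : set (borel Y)).
  rewrite -[D l]setCK; apply: measurableC; apply: sub_sigma_algebra.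
  by apply: closed_openC; apply: closed_pi; exact: closed_closure.
have AD l : A l `<=` pi @^-1` D l.
  by move=> x Ax; exists x => //; exact: subset_closure.
have muE E : measurable (E : set (borel Y)) ->
    mu ord0 (pi @^-1` E) = mu ord_max (pi @^-1` E).
  by move=> mE; rewrite -!(bpushE cpi)// mu01.
have [w [w0 wk wl wz]] := @exists_coupling R _ _ (borel X) (borel Y) n lab mA
  (mu ord0) (mu ord_max) (borel_mfun cpi) D mD AD muE.
have w1 : \sum_(kl : 'I_n * 'I_n) w kl.1 kl.2 = 1.
  rewrite -(pair_bigA _ (fun k l => w k l))/=; under eq_bigr do rewrite wk.
  rewrite sum_fine; last by move=> k _; exact: fin_num_measure.
  have := @sum_measure_label R _ (borel X) n lab mA (mu ord0) setT measurableT.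
  under eq_bigr do rewrite setTI.
  by move=> ->; exact: (congr1 fine (probability_setT (mu ord0))).
(* For a pair of cells with no points over a common image the coupling weight is zero, and the base
   point is taken twice. *)
have /choice[x xP] : forall kl : 'I_n * 'I_n, exists x : 'I_2 -> X,
    pi (x ord0) = pi (x ord_max) /\
    (w kl.1 kl.2 != 0 -> A kl.1 (x ord0) /\ closure (A kl.2) (x ord_max)).
  move=> [k l] /=; have [AD0|/set0P[z [Az [z' cz' piz]]]] := eqVneq (A k `&` pi @^-1` D l) set0.
    by exists (fun=> point); split => //; rewrite wz// eqxx.
  by exists (fun b => if b == ord0 then z else z').
exists ('I_n * 'I_n)%type, (fun kl => w kl.1 kl.2), (fun b kl => x kl b); split => //.
  by move=> kl; have [] := xP kl.
move=> b i.
pose lb (kl : 'I_n * 'I_n) := if b == ord0 then kl.1 else kl.2.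
have bE : b = ord0 \/ b = ord_max by exact: ord2_neq.
have h1 : `|\sum_kl w kl.1 kl.2 * f i (x kl b) - \sum_kl w kl.1 kl.2 * f i (c (lb kl))| <= e / 2.
  apply: weighted_sum_estimate => // kl wkl; apply: labc; have [_ /(_ wkl)[]] := xP kl.
  by rewrite /lb; case: bE => -> //= h _; exact: subset_closure.
have h2 := @label_estimate R _ (borel X) (mu b) n lab (f i) (fun k => f i (c k)) (e / 2) mA
  (bprob_integrable (mu b) (f i) compX)
  (fun z => labc _ _ _ (@subset_closure _ _ z (erefl : A (lab z) z))).
have e12 : \sum_kl w kl.1 kl.2 * f i (c (lb kl)) = \sum_k fine (mu b (A k)) * f i (c k).
  rewrite /lb; case: bE => ->/=.
    rewrite -(pair_bigA _ (fun k l => w k l * f i (c k)))/=.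
    by apply: eq_bigr => k _; rewrite -mulr_suml wk.
  rewrite -(pair_bigA _ (fun k l => w k l * f i (c l)))/= exchange_big/=.
  by apply: eq_bigr => l _; rewrite -mulr_suml wl.
rewrite e12 in h1; rewrite (splitr e).
have -> : \sum_k w k.1 k.2 * f i (x k b) - bprob_eval (mu b) (f i) =
  (\sum_k w k.1 k.2 * f i (x k b) - \sum_k fine (mu b (A k)) * f i (c k)) +
  (\sum_k fine (mu b (A k)) * f i (c k) - bprob_eval (mu b) (f i)) by ring.
by rewrite (le_trans (ler_normD _ _))// lerD// distrC.
Qed.

End ApproximationOfPairs.

Section AtomicPushforward.
Variables (R : realType) (I : finType) (w : I -> R).
Hypotheses (w0 : forall i, 0 <= w i) (w1 : \sum_i w i = 1).

Lemma bpush_atomic (X Y : ptopologicalType) (f : X -> Y) (cf : continuous f) (x : I -> X) :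
  bpush cf (atomic x w0 w1) = atomic (fun i => f (x i)) w0 w1.
Proof.
apply: bprobP => A mA; rewrite bpushE// !atomicE//.
by rewrite -[X in measurable X]setTI; exact: (borel_measurable cf).
Qed.

End AtomicPushforward.

Lemma bpush_equiv (R : realType) (G : groupType) (X Y : ptopologicalType)
    (aX : gaction G X) (aY : gaction G Y) (pi : factor_map aX aY) g (mu : bprob R X) :
  bpush (fmap_continuous pi) (bprob_gaction R aX g mu) =
  bprob_gaction R aY g (bpush (fmap_continuous pi) mu).
Proof.
have cc : continuous (pi \o aX g).
  by move=> x; apply: continuous_comp; [exact: gact_continuous|exact: fmap_continuous].
transitivity (bpush cc mu); first exact/esym/bpush_comp.
by apply: bpush_comp => x /=; exact: fmap_equivariant.
Qed.

Lemma nbhs_bprob2 (R : realType) (X : ptopologicalType) (mu : 'I_2 -> bprob R X)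
    (V : 'I_2 -> set (bprob R X)) : (forall b, nbhs (mu b) (V b)) ->
  exists (I : finType) (f : I -> continuousType X R) (e : R), 0 < e /\
    forall b nu, (forall i, `|bprob_eval nu (f i) - bprob_eval (mu b) (f i)| < e) ->
      V b nu.
Proof.
move=> nV; have [I [f [e [e0 fV]]]] := nbhs_bprob (nV ord0).
have [J [g [d [d0 gV]]]] := nbhs_bprob (nV ord_max).
exists (I + J)%type, (fun k => match k with inl i => f i | inr j => g j end).
exists (Num.min e d); rewrite lt_min e0 d0; split => // b nu h.
have [bE|bE] : b = ord0 \/ b = ord_max by exact: ord2_neq.
  rewrite bE in h *; apply: fV => i; have := h (inl i).
  by rewrite lt_min => /andP[].
rewrite bE in h *; apply: gV => i; have := h (inr i).
by rewrite lt_min => /andP[].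
Qed.

Lemma eq_count_perm (T : eqType) (n : nat) (a b : 'I_n -> T) :
  (forall y, \sum_(i < n) (a i == y) = \sum_(i < n) (b i == y))%N ->
  exists s : 'S_n, forall i, a i = b (s i).
Proof.
move=> ab.
have : perm_eq [tuple a i | i < n] [tuple b i | i < n].
  have cE (c : 'I_n -> T) y : count_mem y [tuple c i | i < n] = (\sum_(i < n) (c i == y))%N.
    rewrite /= count_map -sum1_count big_mkcond big_enum/=.
    by apply: eq_bigr => i _; case: eqP.
  by apply/allP => y _; rewrite /= !cE ab.
move=> /tuple_permP[s sE]; exists s => i.
have : tnth [tuple a i | i < n] i = tnth [tuple tnth [tuple b i | i < n] (s i) | i < n] i.
  by congr tnth; exact: val_inj.
by rewrite !tnth_mktuple.
Qed.

(** * Averages of [n] Dirac measures *)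

Section EmpiricalMeasures.
Variables (R : realType) (n : nat).
Hypothesis n0 : (0 < n)%N.

Definition unif_weight (k : 'I_n) : R := n%:R^-1.

Lemma unif_weight_ge0 k : 0 <= unif_weight k.
Proof. by rewrite invr_ge0. Qed.

Lemma sum_unif_weight : \sum_k unif_weight k = 1.
Proof. by rewrite sumr_const card_ord -[LHS]mulr_natl divff// pnatr_eq0 -lt0n. Qed.

Lemma atomic_bprob_n (T : ptopologicalType) (z : 'I_n -> T) :
  @bprob_n R n T (atomic z unif_weight_ge0 sum_unif_weight).
Proof. by exists z => A mA; rewrite atomicE// ge0_sume_distrr. Qed.

Definition empirical (T : ptopologicalType) (z : 'I_n -> T) : @bprob_n R n T :=
  SigSub (mem_set (atomic_bprob_n z)).

Lemma empirical_surj (T : ptopologicalType) (mu : @bprob_n R n T) :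
  exists z, mu = empirical z.
Proof.
have [z zmu] := set_valP mu; exists z; apply: val_inj; apply: bprobP => A mA.
by rewrite zmu//= -[RHS]/(atomic _ _ _ A) atomicE// ge0_sume_distrr.
Qed.

End EmpiricalMeasures.

(** * From the space to its measures *)

Section Forward.
Variables (R : realType) (G : groupType) (X Y : pmetricType R).
Hypothesis compX : compact [set: X].
Variables (aX : gaction G X) (aY : gaction G Y) (pi : factor_map aX aY).
Hypothesis upe : rel_upe R aX pi.
Hypothesis suppY : supp_system R aY = [set: Y].

(** Common core for all measures and for averages of [n] Dirac measures, with [emb] the inclusion
    into the measures. Moving each atom within [A k b] changes the integrals by at most [e / 2];
    with the initial error [e / 4] they stay within [e] of those of [mu b]. *)
Lemma rel_htop_atomic_gt0 (Z W : topologicalType) (aZ : gaction G Z)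
    (aW : gaction G W) (p : Z -> W) (U : 'I_2 -> set Z) (F : nat -> {fset G})
    (K : finType) (w : K -> R) (w0 : forall k, 0 <= w k) (w1 : \sum_k w k = 1)
    (avg : (K -> X) -> Z) (emb : Z -> bprob R X) (x : 'I_2 -> K -> X)
    (mu : 'I_2 -> bprob R X) (I : finType) (f : I -> continuousType X R) (e : R) :
  (forall g z, p (aZ g z) = aW g (p z)) -> \bigcup_i U i = [set: Z] -> folner R F ->
  (forall z, emb (avg z) = atomic z w0 w1) ->
  (forall g x, aZ g (avg x) = avg (fun k => aX g (x k))) ->
  (forall x x', (forall k, pi (x k) = pi (x' k)) -> p (avg x) = p (avg x')) ->
  0 < e -> (forall k, pi (x ord0 k) = pi (x ord_max k)) ->
  (forall b i, `|\sum_k w k * f i (x b k) - bprob_eval (mu b) (f i)| <= e / 4) ->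
  (forall b z, (forall i, `|bprob_eval (emb z) (f i) - bprob_eval (mu b) (f i)| < e) ->
    ~ U b z) ->
  0 < rel_htop R aZ p F U.
Proof.
move=> p_equiv Ucov fF embE avgE avg_fib e0 xpi xmu VU.
pose A k b := [set z | forall i, `|f i z - f i (x b k)| < e / 2].
have e20 : 0 < e / 2 by rewrite divr_gt0.
have nA k b : nbhs (x b k) (A k b).
  apply: filter_forall => i; have /cvgrPdist_lt/(_ _ e20) := @cts_fun _ _ (f i) (x b k).
  by apply: filterS => z; rewrite distrC.
apply: (@rel_htop_avg_gt0 R G X Y Z W aX aZ aY aW pi p _ p_equiv K avg avgE avg_fib U A)
  => //.
- exact: fmap_equivariant.
- move=> b z Az; apply: VU => i; rewrite embE atomic_eval.
  have := weighted_sum_estimate (a := fun k => f i (z k)) (b := fun k => f i (x b k))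
    w0 w1 (fun k _ => ltW (Az k i)).
  have -> : \sum_k w k * f i (z k) - bprob_eval (mu b) (f i) =
    (\sum_k w k * f i (z k) - \sum_k w k * f i (x b k)) +
    (\sum_k w k * f i (x b k) - bprob_eval (mu b) (f i)) by ring.
  move=> h; rewrite (le_lt_trans (ler_normD _ _))//.
  by rewrite (le_lt_trans (lerD h (xmu b i)))//; lra.
- by move=> k; exact: (pair_dense compX upe suppY (x := fun b => x b k) fF).
- exact: x ord0.
Qed.

Theorem rel_upe_bprob : rel_upe R (bprob_gaction R aX) (bpush (fmap_continuous pi)).
Proof.
move=> U oU Ucov [nu nuU] F fF.
have /choice[mu muP] : forall b, exists mu : bprob R X,
    bpush (fmap_continuous pi) mu = nu /\ ~ closure (U b) mu.
  by move=> b; have /existsNP[mu /not_implyP[]] := nuU b; exists mu.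
have nV b : nbhs (mu b) (~` closure (U b)).
  apply: open_nbhs_nbhs; split; last exact: (muP b).2.
  by apply: closed_openC; exact: closed_closure.
have [I [f [e [e0 fV]]]] := nbhs_bprob2 nV.
have mu01 : bpush (fmap_continuous pi) (mu ord0) = bpush (fmap_continuous pi) (mu ord_max).
  by rewrite (muP ord0).1 (muP ord_max).1.
have [|K [w [x [w0 w1 xpi xmu]]]] := approx_pair compX (image_closed compX (pi := pi)) f mu01
    (_ : 0 < e / 4).
  by rewrite divr_gt0.
apply: (@rel_htop_atomic_gt0 (bprob R X) (bprob R Y) (bprob_gaction R aX)
  (bprob_gaction R aY) (bpush (fmap_continuous pi)) U F K w w0 w1
  (fun z => atomic z w0 w1) id x mu I f e) => //.
- by move=> g m; exact: bpush_equiv.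
- by move=> g z; rewrite /= /bprob_act bpush_atomic.
- move=> z z' zz'; rewrite !bpush_atomic; congr atomic.
  by apply/funext => k; exact: zz'.
- move=> b z /fV nU Uz; apply: nU; exact: subset_closure.
Qed.

Theorem rel_upe_bprob_n (n : nat) : (0 < n)%N ->
  rel_upe R (bprob_n_gaction R n aX) (bpush_n (fmap_continuous pi)).
Proof.
move=> n0 U oU Ucov [nu nuU] F fF.
have /choice[mu muP] : forall b, exists mu : @bprob_n R n X,
    bpush_n (fmap_continuous pi) mu = nu /\ ~ closure (U b) mu.
  by move=> b; have /existsNP[mu /not_implyP[]] := nuU b; exists mu.
have nV b : nbhs (mu b) (~` closure (U b)).
  apply: open_nbhs_nbhs; split; last exact: (muP b).2.
  by apply: closed_openC; exact: closed_closure.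
have /choice[V VP] : forall b, exists V : set (bprob R X),
    nbhs (\val (mu b)) V /\ \val @^-1` V `<=` ~` closure (U b).
  move=> b; have [_ [[V oV <-] Vmu VU]] := nV b; exists V; split => //.
  exact: open_nbhs_nbhs.
have [I [f [e [e0 fV]]]] := nbhs_bprob2 (fun b => (VP b).1).
have nR0 : n%:R != 0 :> R by rewrite pnatr_eq0 -lt0n.
pose w0 := @unif_weight_ge0 R n; pose w1 := sum_unif_weight R n0.
have /choice[x xP] : forall b, exists x : 'I_n -> X, \val (mu b) = atomic x w0 w1.
  by move=> b; have [x ->] := empirical_surj n0 (mu b); exists x.
have mu01 : bpush (fmap_continuous pi) (\val (mu ord0)) =
    bpush (fmap_continuous pi) (\val (mu ord_max)).
  by have := congr1 \val (etrans (muP ord0).1 (esym (muP ord_max).1)).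
(* Equal images give every singleton the same mass, hence the same number of atoms over each [y]. A
   permutation therefore pairs the atoms within fibres, and no approximation occurs. *)
have [|s sP] := @eq_count_perm Y n (fun i => pi (x ord0 i)) (fun i => pi (x ord_max i)).
  move=> y; have my : measurable ([set y] : set (borel Y)).
    rewrite -[[set y]]setCK; apply: measurableC; apply: sub_sigma_algebra.
    apply: closed_openC; apply: accessible_closed_set1.
    exact/hausdorff_accessible/metric_hausdorff.
  have := congr1 (fun m : bprob R Y => m [set y]) mu01.
  rewrite !xP !bpush_atomic !atomicE// /unif_weight -!ge0_sume_distrr//.
  have dE (c : 'I_n -> Y) : (\sum_(i < n) \d_(c i : borel Y) [set y] =
      (\sum_(i < n) (c i == y))%N%:R%:E :> \bar R)%E.
    rewrite natr_sum -sumEFin; apply: eq_bigr => i _; rewrite diracE.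
    have -> // : (c i \in [set y]) = (c i == y).
    by apply/idP/idP => [/set_mem /= ->//|/eqP ci]; apply/mem_set.
  rewrite !dE -!EFinM => -[] /(mulfI _); rewrite invr_eq0 nR0 => /(_ isT)/eqP.
  by rewrite eqr_nat => /eqP.
pose x' (b : 'I_2) := if b == ord0 then x ord0 else fun i => x ord_max (s i).
apply: (@rel_htop_atomic_gt0 (@bprob_n R n X) (@bprob_n R n Y) (bprob_n_gaction R n aX)
  (bprob_n_gaction R n aY) (bpush_n (fmap_continuous pi)) U F 'I_n _ w0 w1
  (@empirical R n n0 X) \val x' (fun b => \val (mu b)) I f e) => //.
- by move=> g m; apply: val_inj; exact: bpush_equiv.
- by move=> g z; apply: val_inj; rewrite /= /bprob_act bpush_atomic.
- move=> z z' zz'; apply: val_inj; rewrite /= !bpush_atomic; congr atomic.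
  by apply/funext => k; exact: zz'.
- move=> b i; rewrite xP atomic_eval /x'.
  have [->|->] : b = ord0 \/ b = ord_max by exact: ord2_neq.
    by rewrite subrr normr0 divr_ge0// ltW.
  rewrite [X in X - _](_ : _ = \sum_k unif_weight R k * f i (x ord_max k)).
    by rewrite subrr normr0 divr_ge0// ltW.
  by rewrite [RHS](reindex_inj (@perm_inj _ s)).
- move=> b z /fV Vz Uz; apply: ((VP b).2 _ Vz); exact: subset_closure.
Qed.

End Forward.

(** * Counting patterns by Hamming distance *)

Section HammingBalls.
Variables (R : realType) (J T : finType) (t : T -> {ffun J -> 'I_2}).
Variable phi : {ffun J -> 'I_2} -> nat.
Hypothesis phi_le : forall s, exists tau, (phi s <= #|[pred g | t tau g != s g]|)%N.

(** The logarithm of [2 * 4 ^ (3 / 4) / 5]; it is positive because [2 ^ 5 > 5 ^ 2]. *)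
Definition hamming_rate : R := 5 / 2 * ln 2 - ln 5.

Lemma hamming_rate_gt0 : 0 < hamming_rate.
Proof.
rewrite /hamming_rate subr_gt0.
have : ln (5 ^+ 2) < ln (2 ^+ 5) :> R.
  by rewrite ltr_ln ?posrE ?exprn_gt0// -!natrX ltr_nat.
by rewrite !lnXn// -(mulr_natr (ln 5)) -(mulr_natr (ln 2)); lra.
Qed.

Lemma sum_hamming (tau : T) :
  \sum_(s : {ffun J -> 'I_2}) (4 : R) ^+ #|[pred g | t tau g != s g]| = 5 ^+ #|J|.
Proof.
transitivity (\sum_(s : {ffun J -> 'I_2}) \prod_g (if t tau g != s g then 4 else 1 : R)).
  by apply: eq_bigr => s _; rewrite -big_mkcond prodr_const.
rewrite -(bigA_distr_bigA (fun g i => if t tau g != i then 4 else 1 : R)).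
rewrite (eq_bigr (fun=> 5)) ?prodr_const// => g _.
rewrite big_ord_recl big_ord1; case: (t tau g) => [[|[|//]]] ?;
  rewrite -!val_eqE/= ?lift0/=; lra.
Qed.

(** An exponential moment with base 4: the sum of [4 ^ phi s] is at most [#|T| 5 ^ #|J|], since each
    coordinate contributes [1 + 4], and by convexity at least [2 ^ #|J|] times [4] to the power
    [3 #|J| / 4]. *)
Lemma card_ge_of_mean : 3 / 4 * #|J|%:R * 2 ^+ #|J| <= (\sum_s phi s)%N%:R :> R ->
  expR (hamming_rate * #|J|%:R) <= #|T|%:R.
Proof.
set j := #|J| => phi_mean; pose a : R := 3 / 4 * j%:R; pose L : R := ln 4.
have L4 : expR L = 4 by rewrite lnK ?posrE.
have L0 : 0 <= L by apply: ln_ge0; rewrite ler1n.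
have up : \sum_s (4 : R) ^+ phi s <= #|T|%:R * 5 ^+ j.
  apply: (@le_trans _ _ (\sum_(s : {ffun J -> 'I_2}) \sum_(tau : T) (4 : R) ^+ #|[pred g | t tau g != s g]|)).
    apply: ler_sum => s _; have [tau tauP] := phi_le s.
    rewrite (bigD1 tau)//= ler_wpDr//.
      by apply: sumr_ge0 => ? _; exact: exprn_ge0.
    by apply: ler_weXn2l => //; rewrite ler1n.
  rewrite exchange_big/= (eq_bigr (fun=> 5 ^+ j)); last by move=> tau _; exact: sum_hamming.
  by rewrite sumr_const mulr_natl.
have sum_cst (c : R) : \sum_(s : {ffun J -> 'I_2}) c = c * 2 ^+ j.
  by rewrite sumr_const -[LHS]mulr_natr card_ffun card_ord natrX.
(* tangent line of the exponential at the mean value *)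
have low : 2 ^+ j * expR (L * a) <= \sum_s (4 : R) ^+ phi s.
  apply: (@le_trans _ _ (\sum_s expR (L * a) * (1 + L * ((phi s)%:R - a)))).
    rewrite -mulr_sumr mulrC ler_pM2l ?expR_gt0// big_split/= sum_cst mul1r lerDl.
    rewrite -mulr_sumr mulr_ge0// sumrB -natr_sum sum_cst subr_ge0.
    exact: phi_mean.
  apply: ler_sum => s _; rewrite -L4 -expRM_natl.
  have -> : (phi s)%:R * L = L * a + L * ((phi s)%:R - a) by ring.
  by rewrite expRD ler_pM2l ?expR_gt0// expR_ge1Dx.
have := le_trans low up; rewrite -ler_pdivrMr ?exprn_gt0//; apply: le_trans.
rewrite ler_pdivlMr ?exprn_gt0//.
have E5 : (5 : R) ^+ j = expR (j%:R * ln 5) by rewrite expRM_natl lnK ?posrE.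
have E2 : (2 : R) ^+ j = expR (j%:R * ln 2) by rewrite expRM_natl lnK ?posrE.
have L2 : L = 2 * ln 2.
  by rewrite /L (_ : 4 = 2 ^+ 2) ?lnXn// ?mulr_natl// -natrX.
rewrite E5 E2 -!expRD ler_expR L2 /a /hamming_rate; lra.
Qed.

End HammingBalls.

Lemma sum_ord_ltn (j m : nat) : (\sum_(k < j) (k < m) = minn j m)%N.
Proof. by elim: j => [|j IH]; rewrite ?big_ord0 ?min0n// big_ord_recr/= IH; lia. Qed.

(** * A fibre following many patterns for three quarters of the time *)

Section PopularFiber.
Variables (R : realType) (G : groupType) (X Y : ptopologicalType).
Variables (aX : gaction G X) (aY : gaction G Y) (pi : factor_map aX aY).
Hypothesis compX : compact [set: X].
Hypothesis closed_pi : forall C, closed C -> closed (pi @` C).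
Variables (K : 'I_2 -> set X) (f : 'I_2 -> continuousType X R).
Hypothesis closedK : forall i, closed (K i).
Hypothesis f_ge0 : forall i x, 0 <= f i x.
Hypothesis f_leK : forall i x, f i x <= `[< K i x >]%:R.
Variables (J : {fset G}) (mu : {ffun J -> 'I_2} -> bprob R X) (nu : bprob R Y).
Hypothesis mu_nu : forall s, bpush (fmap_continuous pi) (mu s) = nu.
Hypothesis mu_f : forall s (g : J),
  3 / 4 <= bprob_eval (bprob_act aX (\val g) (mu s)) (f (s g)).

Let hits (s : {ffun J -> 'I_2}) x : {set J} :=
  [set g : J | `[< K (s g) (aX (\val g) x) >]]%SET.

(** The points over which some point follows [s] in at least [k] places. Written as a finite union
    of images of closed sets, this set is visibly Borel. *)
Let D (s : {ffun J -> 'I_2}) (k : nat) : set (borel Y) :=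
  \bigcup_(B in [set B : {set J} | (k <= #|B|)%N])
    (pi @` (\bigcap_(g in [set` B]) [set x | K (s g) (aX (\val g) x)])).

Let mD s k : measurable (D s k).
Proof.
apply: fin_bigcup_measurable; first exact: finite_finset.
move=> B _; rewrite -[X in measurable X]setCK; apply: measurableC.
apply: sub_sigma_algebra; apply: closed_openC; apply: closed_pi.
apply: closed_bigI => g _.
apply: (@preimage_closed _ _ (aX (\val g)) (K (s g))); last exact: closedK.
by move=> x _; exact: gact_continuous.
Qed.

Let hits_D s x k : (k < #|hits s x|)%N -> D s k.+1 (pi x).
Proof.
by move=> kh; exists (hits s x) => //; exists x => // g /=; rewrite inE => /asboolP.
Qed.

(** Layer-cake summation: a point [x] with [h] hits lies over [D s 1], ..., [D s h], and its number
    of hits dominates the sum of the functions [f (s g)] along its orbit, whose mean is at least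
    [3 / 4 * #|J|]. *)
Let mean_D s : ((3 / 4 * #|` J|%:R)%:E <= \sum_(k < #|` J|) nu (D s k.+1))%E.
Proof.
have mpi k : measurable (pi @^-1` D s k : set (borel X)).
  by rewrite -[X in measurable X]setTI; exact: (borel_measurable (fmap_continuous pi)).
have -> : (\sum_(k < #|` J|) nu (D s k.+1) =
    \int[mu s]_x \sum_(k < #|` J|) (\1_(pi @^-1` D s k.+1) x : R)%:E)%E.
  rewrite ge0_integral_sum//; last first.
    by move=> k; apply/measurable_EFinP; exact: measurable_indic.
  apply: eq_bigr => k _; rewrite integral_indic// setIT -(mu_nu s).
  by rewrite bpushE.
have mf (g : J) : measurable_fun [set: borel X] (fun x => (f (s g) (aX (\val g) x))%:E).
  apply/measurable_EFinP; apply: borel_measurableR => x.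
  by apply: continuous_comp; [exact: gact_continuous|exact: cts_fun].
apply: (@le_trans _ _ (\int[mu s]_x \sum_(g : J) (f (s g) (aX (\val g) x))%:E)%E).
  rewrite ge0_integral_sum//; last by move=> g x _; rewrite lee_fin.
  rewrite cardfE -sum1_card natr_sum mulr_sumr -sumEFin; apply: lee_sum => g _.
  rewrite mulr1; have := mu_f s g; rewrite /bprob_act bpush_eval -lee_fin => /le_trans; apply.
  rewrite /bprob_eval /Rintegral fineK//.
  by apply: integrable_fin_num => //; exact: bprob_integrable.
apply: ge0_le_integral => //.
- by move=> x _; rewrite sume_ge0// => g _; rewrite lee_fin.
- exact: emeasurable_sum.
- by apply: emeasurable_sum => k; apply/measurable_EFinP; exact: measurable_indic.
move=> x _; apply: (@le_trans _ _ (#|hits s x|%:R)%:E).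
  rewrite sumEFin lee_fin -sum1_card natr_sum [leRHS]big_mkcond/=.
  apply: ler_sum => g _; rewrite inE; apply: le_trans (f_leK _ _) _.
  by case: ifP.
rewrite sumEFin lee_fin.
apply: (@le_trans _ _ (\sum_(k < #|` J|) (k < #|hits s x|)%N%:R)).
  rewrite -natr_sum ler_nat sum_ord_ltn leq_min leqnn andbT cardfE.
  exact: max_card.
apply: ler_sum => k _; case: ltnP => [kh|_]; last by rewrite indicE ler0n.
by rewrite indicE mem_set//; exact: hits_D.
Qed.

(** All patterns and levels are averaged over [nu] at once, which produces one [y] for all [s];
    [phi s] counts the levels [D s k.+1] that contain [y]. *)
Lemma popular_fiber : exists y (phi : {ffun J -> 'I_2} -> nat),
  3 / 4 * #|` J|%:R * 2 ^+ #|` J| <= (\sum_s phi s)%N%:R :> R /\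
  forall s, exists2 x, pi x = y & (phi s <= #|hits s x|)%N.
Proof.
have [|y yP] := @exists_ge_mean R _ (borel Y) nu ({ffun J -> 'I_2} * 'I_#|` J|)%type
  (index_enum _) (fun sk => D sk.1 sk.2.+1) (3 / 4 * #|` J|%:R * 2 ^+ #|` J|)
  (fun sk => mD _ _).
  rewrite -(pair_bigA _ (fun s (k : 'I_#|` J|) => nu (D s k.+1)))/=.
  apply: (@le_trans _ _ (\sum_(s : {ffun J -> 'I_2}) (3 / 4 * #|` J|%:R)%:E)%E).
    rewrite sumEFin lee_fin sumr_const card_ffun card_ord -cardfE.
    by rewrite -[leRHS]mulr_natr natrX.
  by apply: lee_sum => s _.
exists y, (fun s => \sum_(k < #|` J|) `[< D s k.+1 y >])%N; split.
  by rewrite (pair_bigA _ (fun s (k : 'I_#|` J|) => `[< D s k.+1 y >] : nat))/=.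
move=> s; pose P k := `[< D s k y >].
(* Level 0 is all of [Y], so a largest level [m] containing [y] exists; [phi s] counts only levels
   from 1 to [m]. *)
have exP : exists k, P k.
  exists 0%N; apply/asboolP; have [x xy] := fmap_surj pi y.
  by exists finset.set0 => //; exists x => // g /=; rewrite inE.
have Pj k : P k -> (k <= #|` J|)%N.
  by move=> /asboolP[B /= kB _]; apply: (leq_trans kB); rewrite cardfE max_card.
case: (ex_maxnP exP Pj) => m /asboolP[B /= mB [x xB xy]] mmax.
exists x => //; apply: (@leq_trans m).
  apply: (@leq_trans (\sum_(k < #|` J|) (k < m)%N)).
    apply: leq_sum => k _; case: (boolP `[< _ >]) => //= Dk.
    by rewrite (mmax k.+1 Dk).
  by rewrite sum_ord_ltn geq_minr.
apply: (leq_trans mB); apply: fintype.subset_leq_card; apply/fintype.subsetP => g gB.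
by rewrite inE; apply/asboolP; exact: xB.
Qed.

End PopularFiber.

(** * From measures back to the space *)

Section Backward.
Variables (R : realType) (G : groupType) (X Y : pmetricType R).
Hypothesis compX : compact [set: X].
Variables (aX : gaction G X) (aY : gaction G Y) (pi : factor_map aX aY).
Variables (Z W : topologicalType) (aZ : gaction G Z) (aW : gaction G W) (p : Z -> W).
Variables (emb : Z -> bprob R X) (dir : X -> Z).
Hypothesis p_equiv : forall g z, p (aZ g z) = aW g (p z).
Hypothesis emb_cont : continuous emb.
Hypothesis emb_equiv : forall g z, emb (aZ g z) = bprob_act aX g (emb z).
Hypothesis emb_fiber : forall z z', p z = p z' ->
  bpush (fmap_continuous pi) (emb z) = bpush (fmap_continuous pi) (emb z').
Hypothesis dirE : forall x (f : continuousType X R), bprob_eval (emb (dir x)) f = f x.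
Hypothesis dir_fiber : forall x x', pi x = pi x' -> p (dir x) = p (dir x').

Lemma exists_bump (x : X) (C : set X) : closed C -> ~ C x ->
  exists f : continuousType X R, [/\ forall z, 0 <= f z <= 1, f x = 1 &
    forall z, C z -> f z = 0].
Proof.
move=> cC Cx.
have /(@uniform_separatorP _ R)[f [cf f01 fx fC]] : uniform_separator [set x] C.
  exact: uniform_completely_regular.
have cg : continuous (fun z => 1 - f z).
  by move=> z; apply: cvgB; [exact: cvg_cst|exact: cf].
exists (mkcts cg); split => /=.
- move=> z; have : `[0, 1]%classic (f z) by apply: f01; exists z.
  by rewrite /= in_itv/= => /andP[f0 f1]; rewrite subr_ge0 f1 lerBlDr lerDl f0.
- by apply: (etrans (_ : _ = 1 - f x)) => //; rewrite (fx (f x)) ?subr0//; exists x.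
- move=> z Cz; apply: (etrans (_ : _ = 1 - f z)) => //.
  by rewrite (fC (f z)) ?subrr//; exists z.
Qed.

(** Stated for any system [Z] mapping equivariantly to the measures on [X] and containing the Dirac
    measures through [dir], so that it covers all measures and averages of [n] Dirac measures
    alike. *)
Theorem rel_upe_of_measures : rel_upe R aZ p -> rel_upe R aX pi.
Proof.
move=> upe U oU Ucov [y ndy] F fF.
have ix (i : 'I_2) : i = ord0 \/ i = ord_max by exact: ord2_neq.
have /choice[x xP] : forall i, exists x, pi x = y /\ ~ closure (U i) x.
  by move=> i; have /existsNP[x /not_implyP[]] := ndy i; exists x.
have /choice[f fP] : forall i, exists f : continuousType X R,
    [/\ forall z, 0 <= f z <= 1, f (x i) = 1 & forall z, closure (U i) z -> f z = 0].
  by move=> i; apply: exists_bump; [exact: closed_closure|exact: (xP i).2].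
have f0 i z : 0 <= f i z by have [/(_ z)/andP[]] := fP i.
have f1 i z : f i z <= 1 by have [/(_ z)/andP[]] := fP i.
have fU i z : U i z -> f i z = 0.
  by move=> Uz; have [_ _] := fP i; apply; exact: subset_closure.
(* At every point one of the two bumps vanishes, so their integrals sum to at most 1 and a threshold
   above [1 / 2] gives a cover. A threshold below 1 keeps the Dirac measure at [x i] outside the
   closure of [V i], and [3 / 4] is the value behind [hamming_rate]. *)
pose V i := [set z | bprob_eval (emb z) (f i) < 3 / 4].
have cev i : continuous (fun z => bprob_eval (emb z) (f i) : R).
  move=> z.
  apply: (@continuous_comp _ _ _ emb (fun m : bprob R X => bprob_eval m (f i) : R)).
    exact: emb_cont.
  exact: bprob_eval_continuous.
have oV i : open (V i).
  by apply: (@open_comp _ _ (fun z => bprob_eval (emb z) (f i)) [set t | t < 3 / 4]);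
    [move=> z _; exact: cev|exact: open_lt].
have Vcov : \bigcup_i V i = [set: Z].
  apply/seteqP; split => // z _; apply: contrapT => nV.
  have ge i : 3 / 4 <= bprob_eval (emb z) (f i).
    by rewrite leNgt; apply/negP => h; apply: nV; exists i.
  have int i := bprob_integrable (emb z) (f i) compX.
  have : bprob_eval (emb z) (f ord0) + bprob_eval (emb z) (f ord_max) <= 1.
    rewrite -RintegralD//.
    have P1 : fine (emb z setT) = 1 by exact: (congr1 fine (probability_setT (emb z))).
    apply: (@le_trans _ _ (\int[emb z]_(x in setT) 1)); last first.
      by rewrite Rintegral_cst// P1 mulr1.
    apply: le_Rintegral => //.
    - by have := integrableD measurableT (int ord0) (int ord_max); apply: eq_integrable.
    - exact: finite_measure_integrable_cst.
    move=> t _; have : [set: X] t by []; rewrite -Ucov => -[i _ Ut].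
    by case: (ix i) => e; rewrite e in Ut; rewrite (fU _ _ Ut) ?add0r ?addr0.
  by have := ge ord0; have := ge ord_max; lra.
have Vnd : nondense_on_fiber p V.
  exists (p (dir (x ord0))) => i /(_ (dir (x i))) h.
  have /h : p (dir (x i)) = p (dir (x ord0)).
    by apply: dir_fiber; rewrite (xP i).1 (xP ord0).1.
  have cl : closed [set z | bprob_eval (emb z) (f i) <= 3 / 4].
    by apply: (@preimage_closed _ _ (fun z => bprob_eval (emb z) (f i)) [set t | t <= 3 / 4]);
      [move=> z _; exact: cev|exact: closed_le].
  move=> /(closure_subset (_ : V i `<=` [set z | bprob_eval (emb z) (f i) <= 3 / 4])) h'.
  have : closure [set z | bprob_eval (emb z) (f i) <= 3 / 4] (dir (x i)).
    by apply: h' => z /ltW.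
  by rewrite -(closure_id _).1//= dirE; have [_ -> _] := fP i; lra.
have [d d0 dP] := rel_htop_independent p_equiv (dir (x ord0)) Vcov fF (upe V oV Vcov Vnd F fF).
have hr0 := hamming_rate_gt0 R.
apply: (rel_htop_gt0 (x ord0) (fmap_equivariant pi) Ucov fF (mulr_gt0 hr0 d0)).
apply: filterS dP => n [J [JF [q qP] dJ]].
pose ext (s : {ffun J -> 'I_2}) g := if insub g is Some g' then s g' else ord0.
have /choice[z zP] : forall s : {ffun J -> 'I_2}, exists z, p z = q /\
    forall g : J, ~ V (s g) (aZ (\val g) z).
  move=> s; have [z zq zV] := qP (ext s); exists z; split => // g.
  by have := zV _ (valP g); rewrite /ext valK.
have [||||y' [phi [phim phiP]]] := @popular_fiber R G X Y aX aY pi compX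
  (image_closed compX (pi := pi)) (fun i => ~` U i) f _ f0 _ J (fun s => emb (z s))
  (bpush (fmap_continuous pi) (emb (z [ffun=> ord0]))) _ _.
- by move=> i; exact: open_closedC.
- move=> i t; have [Ut|Ut] := pselect (U i t); first by rewrite fU.
  by rewrite asboolT.
- by move=> s; apply: emb_fiber; rewrite !(zP _).1.
- move=> s g; rewrite -emb_equiv leNgt; apply/negP; exact: (zP s).2.
exists y' => N [T [t [TN tP]]].
have := @card_ge_of_mean R J T (fun tau => [ffun g : J => t tau (\val g)]) phi.
rewrite -cardfE => /(_ _ phim) h.
apply: (@le_trans _ _ #|T|%:R); last by rewrite ler_nat.
apply: (@le_trans _ _ (expR (hamming_rate R * #|` J|%:R))).
  by rewrite ler_expR -mulrA ler_pM2l.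
(* Where [w] follows [s] it lies outside [U (s g)], while the cover element [tau] places it in the
   set named by [tau] at [g]; so [tau] and [s] disagree at each of these [g]. *)
apply: h => s; have [w wy wP] := phiP s; have [tau tauP] := tP w wy.
exists tau; apply: (leq_trans wP); apply: fintype.subset_leq_card.
apply/fintype.subsetP => g; rewrite !inE ffunE => /asboolP nU; apply/eqP => e.
move/asboolP : nU; apply; rewrite -e; apply: tauP; move/fsubsetP: JF; apply; exact: valP.
Qed.

End Backward.

Theorem theorem1p1 (R : realType) (G : groupType)
  (countG : countable [set: G]) (infG : infinite_set [set: G])
  (amenG : amenable R G)
  (X Y : pmetricType R)
  (compX : compact [set: X]) (compY : compact [set: Y])
  (aX : gaction G X) (aY : gaction G Y) (pi : factor_map aX aY)
  (suppY : supp_system R aY = [set: Y]) :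
  [<-> rel_upe R aX pi;
       exists2 n : nat, (0 < n)%N &
         rel_upe R (bprob_n_gaction R n aX) (bpush_n (fmap_continuous pi));
       forall n : nat, (0 < n)%N ->
         rel_upe R (bprob_n_gaction R n aX) (bpush_n (fmap_continuous pi));
       rel_upe R (bprob_gaction R aX) (bpush (fmap_continuous pi))].
Proof.
(* The Dirac measure at [x] is the average over the constant tuple [x]. *)
have upe_of_n n : (0 < n)%N ->
    rel_upe R (bprob_n_gaction R n aX) (bpush_n (fmap_continuous pi)) -> rel_upe R aX pi.
  move=> n0.
  apply: (@rel_upe_of_measures R G X Y compX aX aY pi _ _
    (bprob_n_gaction R n aX) (bprob_n_gaction R n aY) (bpush_n (fmap_continuous pi))
    \val (fun x => empirical R n0 (fun=> x))).
  - by move=> g mu; apply: val_inj; exact: bpush_equiv.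
  - exact: initial_continuous.
  - by [].
  - by move=> mu mu' /(congr1 \val).
  - move=> x f; rewrite /= -[LHS]/(bprob_eval (atomic _ _ _) f) atomic_eval.
    by rewrite -mulr_suml sum_unif_weight// mul1r.
  - move=> x x' xx'; apply: val_inj; rewrite /= !bpush_atomic; congr atomic.
    by apply/funext => k.
(* The first implication takes [n = 1]; the second and third pass through (1), the third by way of
   [n = 1]. In the last one Dirac measures are atomic measures over [unit] with weight 1. *)
tfae.
- by move=> upe; exists 1%N => //; exact: rel_upe_bprob_n.
- by move=> [m m0 /(upe_of_n _ m0) upe] n n0; exact: rel_upe_bprob_n.
- by move=> h; apply: rel_upe_bprob => //; exact: (upe_of_n 1%N isT (h 1%N isT)).
have w0 (k : unit) : 0 <= (1 : R) by [].
have w1 : \sum_(k : unit) (1 : R) = 1 by rewrite sumr_const card_unit.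
apply: (@rel_upe_of_measures R G X Y compX aX aY pi _ _
  (bprob_gaction R aX) (bprob_gaction R aY) (bpush (fmap_continuous pi))
  id (fun x => atomic (fun=> x) w0 w1)) => //.
- by move=> g mu; exact: bpush_equiv.
- by move=> mu; exact: cvg_id.
- move=> x f; rewrite -[LHS]/(bprob_eval (atomic (fun=> x) w0 w1) f) atomic_eval.
  by rewrite -mulr_suml w1 mul1r.
- move=> x x' xx'; rewrite !bpush_atomic; congr atomic.
  by apply/funext => k.
Qed.
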